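(* Let $\mathbb{F}_\omega$ be the free group on the $\omega$ many generators $\gamma_0,\gamma_1,\ldots$ and let $X=\operatorname{Free}((2^\omega)^{\mathbb{F}_\omega})$. To each $x\in X$ associate the single countable sequence $\gamma_0\cdot x,\gamma_1\cdot x,\ldots$, which does not include $x$. Then for all Borel functions $f\colon X\to 2^\omega$, there exists an $x\in X$ such that $$f(x)\leq_1 f(\gamma_0\cdot x)\oplus f(\gamma_1\cdot x)\oplus\cdots.$$ Indeed, there is an $x\in X$ such that $f(x)(i)=f(\gamma_i\cdot x)(i)$ for all $i\in\omega$.
   Context: $\mathbb{F}_\omega$ acts on $(2^\omega)^{\mathbb{F}_\omega}$ by the left shift $(\gamma\cdot x)(\delta)=x(\gamma^{-1}\delta)$, and $\operatorname{Free}((2^\omega)^{\mathbb{F}_\omega})$ is the set of $x$ with $\gamma\cdot x\neq x$ for all $\gamma\neq 1$. For $x,y\in 2^\omega$, $x\leq_1 y$ (one-one reducibility) means there is a computable injection $\rho\colon\omega\to\omega$ with $x(n)=y(\rho(n))$ for all $n$. Fixing a computable bijection $\langle\cdot,\cdot\rangle\colon\omega^2\to\omega$, the countable join $y_0\oplus y_1\oplus\cdots$ is the element of $2^\omega$ whose value at $\langle n,m\rangle$ is $y_n(m)$. *)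

(* Defs.v *)
From HB Require Import structures.
From mathcomp Require Import all_boot.
From mathcomp Require Import all_classical reals topology cantor.
From mathcomp Require Import measurable_structure.

Set Implicit Arguments.
Unset Strict Implicit.
Unset Printing Implicit Defensive.

Local Open Scope classical_set_scope.

(** * The free group on generators indexed by [nat] *)

(* The letter (i, true) stands for the i-th generator and (i, false) for its
   inverse; group elements are the words without adjacent inverse letters. *)
Definition letter : Type := (nat * bool)%type.

Definition linv (a : letter) : letter := (a.1, ~~ a.2).

Definition reduced (w : seq letter) : bool :=
  sorted (fun a b => b != linv a) w.

Record free_group : Type := FreeGroup {
  fg_word :> seq letter;
  fg_reduced : reduced fg_word }.

HB.instance Definition _ := [isSub for fg_word].
HB.instance Definition _ := [Countable of free_group by <:].

Definition lcons (a : letter) (w : seq letter) : seq letter :=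
  if w is b :: w' then if b == linv a then w' else a :: w else [:: a].

Definition wmul (u v : seq letter) : seq letter := foldr lcons v u.

Definition winv (w : seq letter) : seq letter := rev (map linv w).

Lemma linvK : involutive linv.
Proof. by case=> i b; rewrite /linv /= negbK. Qed.

Lemma reduced_lcons a w : reduced w -> reduced (lcons a w).
Proof.
case: w => //= b w' rw; case: (boolP (b == linv a)) => [_|nba].
  exact: (path_sorted rw).
by rewrite /reduced /= nba.
Qed.

Lemma lconsK a w : reduced w -> lcons a (lcons (linv a) w) = w.
Proof.
case: w => [_|b w' rw] /=; first by rewrite eqxx.
rewrite linvK; case: (eqVneq b a) => [ba|_] /=; last by rewrite eqxx.
case: w' rw => [|c w''] /=; first by rewrite ba.
by rewrite ba => /andP[/negbTE -> _].
Qed.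

Lemma reduced_wmul u v : reduced v -> reduced (wmul u v).
Proof. by move=> rv; elim: u => //= a u /(reduced_lcons a). Qed.

Lemma wmul_lcons a v w :
  reduced w -> wmul (lcons a v) w = lcons a (wmul v w).
Proof.
move=> rw; case: v => [|b v] //=.
case: (eqVneq b (linv a)) => [->|//].
by rewrite lconsK //; exact: reduced_wmul.
Qed.

Lemma wmulA u v w : reduced w -> wmul u (wmul v w) = wmul (wmul u v) w.
Proof. by move=> rw; elim: u => //= a u ->; rewrite wmul_lcons. Qed.

Lemma wmulw0 w : reduced w -> wmul w [::] = w.
Proof.
elim: w => //= a w IHw rw; rewrite IHw; last exact: (path_sorted rw).
by case: w rw {IHw} => //= b w /andP[/negbTE ->].
Qed.

Lemma reduced_winv w : reduced w -> reduced (winv w).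
Proof.
rewrite /reduced /winv rev_sorted sorted_map; apply: sub_sorted => a b /=.
by rewrite (inj_eq (inv_inj linvK)) eq_sym -(inj_eq (inv_inj linvK)) linvK.
Qed.

Lemma winvK : involutive winv.
Proof. by move=> w; rewrite /winv map_rev revK (mapK linvK). Qed.

Lemma wmulVw w : wmul (winv w) w = [::].
Proof.
rewrite /wmul /winv; elim: w => //= a w IHw.
by rewrite rev_cons foldr_rcons /= linvK eqxx.
Qed.

Definition fg_one : free_group := @FreeGroup [::] isT.

Definition fg_mul (g h : free_group) : free_group :=
  FreeGroup (reduced_wmul g (fg_reduced h)).

Definition fg_inv (g : free_group) : free_group :=
  FreeGroup (reduced_winv (fg_reduced g)).

Lemma fg_mulA : associative fg_mul.
Proof. by move=> g h k; apply: val_inj; exact: wmulA (fg_reduced k). Qed.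

Lemma fg_mul1g : left_id fg_one fg_mul.
Proof. by move=> g; apply: val_inj. Qed.

Lemma fg_mulg1 : right_id fg_one fg_mul.
Proof. by move=> g; apply: val_inj; exact: wmulw0 (fg_reduced g). Qed.

Lemma fg_mulVg : left_inverse fg_one fg_inv fg_mul.
Proof. by move=> g; apply: val_inj; exact: wmulVw. Qed.

Lemma fg_mulgV : right_inverse fg_one fg_inv fg_mul.
Proof.
by move=> g; apply: val_inj; rewrite /= -{1}[val g]winvK; exact: wmulVw.
Qed.

HB.instance Definition _ := isGroup.Build free_group
  fg_mulA fg_mul1g fg_mulg1 fg_mulVg fg_mulgV.

Definition gen (i : nat) : free_group := @FreeGroup [:: (i, true)] isT.

(** * The shift action and its free part *)

Definition shift_space : Type :=
  prod_topology (fun _ : free_group => cantor_space).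

HB.instance Definition _ := Topological.on shift_space.

Definition shift (g : free_group) (x : shift_space) : shift_space :=
  fun d => x (g^-1 * d)%g.

Definition free_part : set shift_space :=
  [set x | forall g : free_group, g <> 1%g -> shift g x <> x].

Lemma shiftM g h x : shift (g * h)%g x = shift g (shift h x).
Proof. by apply/funext => d; rewrite /shift invgM mulgA. Qed.

Lemma shift1 x : shift 1%g x = x.
Proof. by apply/funext => d; rewrite /shift invg1 mul1g. Qed.

Lemma shift_free_part g x : x \in free_part -> shift g x \in free_part.
Proof.
rewrite !inE => fx h h1 hgx; apply: (fx (g^-1 * h * g)%g).
  by move=> /(congr1 (fun k => (g * k * g^-1)%g)); rewrite !mulgA mulgV mul1g
    mulgK mulg1 mulgV => /h1.
by rewrite !shiftM hgx -shiftM mulVg shift1.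
Qed.

(* The coercion from sets to types makes [free_part] a type, which carries the
   subspace topology. *)
Definition free_shift (g : free_group) (x : free_part) : free_part :=
  SigSub (shift_free_part g (valP x)).

(** * Borel functions *)

Definition borel_set (T : topologicalType) : set (set T) := <<s open >>.

Definition borel_fun (S T : topologicalType) (f : S -> T) : Prop :=
  forall B : set T, borel_set B -> borel_set (f @^-1` B).

(** * Computable functions *)

(* Kleene's partial recursive functions; [rec_code n] is the type of programs
   for n-ary functions. *)
Inductive rec_code : nat -> Type :=
| RZero n : rec_code n
| RSucc : rec_code 1
| RProj n (i : 'I_n) : rec_code n
| RComp m n (f : rec_code m) (g : 'I_m -> rec_code n) : rec_code n
| RPrec n (f : rec_code n) (g : rec_code n.+2) : rec_code n.+1
| RMu n (f : rec_code n.+1) : rec_code n.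

(* [rec_eval c v y]: the program c halts on input v with output y.  The
   recursion variable of [RPrec] and the variable minimized by [RMu] come
   first; in the case of [RPrec], s lists the successive values. *)
Fixpoint rec_eval n (c : rec_code n) : n.-tuple nat -> nat -> Prop :=
  match c in rec_code n return n.-tuple nat -> nat -> Prop with
  | RZero _ => fun _ y => y = 0
  | RSucc => fun v y => y = (thead v).+1
  | RProj _ i => fun v y => y = tnth v i
  | RComp m _ f g => fun v y => exists2 w : m.-tuple nat,
      forall i, rec_eval (g i) v (tnth w i) & rec_eval f w y
  | RPrec _ f g => fun v y => exists s : nat -> nat,
      [/\ rec_eval f [tuple of behead v] (s 0),
          forall k, k < thead v ->
            rec_eval g [tuple of k :: s k :: behead v] (s k.+1)
        & y = s (thead v)]
  | RMu _ f => fun v y =>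
      rec_eval f [tuple of y :: v] 0 /\
      forall k, k < y -> exists z, rec_eval f [tuple of k :: v] z.+1
  end.

Definition computable n (F : n.-tuple nat -> nat) : Prop :=
  exists c : rec_code n, forall v, rec_eval c v (F v).

Definition computable1 (r : nat -> nat) : Prop :=
  computable (fun v : 1.-tuple nat => r (tnth v ord0)).

Definition computable2 (p : nat * nat -> nat) : Prop :=
  computable (fun v : 2.-tuple nat => p (tnth v ord0, tnth v ord_max)).

(** * One-one reducibility and countable joins *)

Definition one_one_reducible (x y : cantor_space) : Prop :=
  exists r : nat -> nat,
    [/\ computable1 r, injective r & forall n, x n = y (r n)].

Record pairing : Type := Pairing {
  pair_code :> nat * nat -> nat;
  unpair : nat -> nat * nat;
  pair_codeK : cancel pair_code unpair;
  unpairK : cancel unpair pair_code;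
  pair_code_computable : computable2 pair_code }.

Definition countable_join (p : pairing) (y : nat -> cantor_space) :
  cantor_space := fun k => y (unpair p k).1 (unpair p k).2.

Lemma countable_joinE (p : pairing) (y : nat -> cantor_space) n m :
  countable_join p y (p (n, m)) = y n m.
Proof. by rewrite /countable_join pair_codeK. Qed.

(* Main.v *)
Require Import Defs.
From HB Require Import structures.
From mathcomp Require Import all_boot ssralg ssrnum ssrint.
From mathcomp Require Import all_classical reals topology cantor.
From mathcomp Require Import measurable_structure.
From mathcomp Require Import zify.

Set Implicit Arguments.
Unset Strict Implicit.
Unset Printing Implicit Defensive.

Local Open Scope classical_set_scope.

(* Suppose that every free x has some i with f(x)(i) <> f(g_i x)(i).  Then the
   sets D_i of the free x with f(x)(i) <> f(g_i x)(i) cover the free part, and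
   they can be extended by Borel sets to a cover of the whole shift space in such
   a way that no infinite g_i-orbit of non-free points is contained in D_i: a
   non-free orbit contains cycles, and x is put into D_i if the step from x
   along, or towards, a chosen family of disjoint cycles uses the generator g_i.

   In the i-th game player I builds x on the words starting with g_i or its
   inverse, player II builds the rest, and II wins if x is in D_i.  The games are
   Borel, hence determined.  Winning strategies of I in all of them could be
   played against each other and would yield a point outside all D_i.  So II
   wins some game, for two different values at the identity and the same i, and
   playing his strategies at all points of a g_i-orbit yields a continuous
   equivariant map y |-> x(y) from {0,1}^Z whose values are in D_i.  For
   aperiodic y the point x(y) is then free, and f(x(y))(i) is a Borel colouring
   which alternates along the shift orbit of y, contradicting Baire category.

   Borel determinacy is proved by Martin's unravelling method; allowing terminal
   nodes, at which the player to move loses, makes the auxiliary game simpler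
   than the usual one with quasi-strategies as moves. *)

(** * Borel determinacy *)

(** The cover has to include the non-free points, since nothing makes the point produced by the
    strategies of I free. On the other hand II must be unable to keep a whole g_i-line of non-free
    points in D_i; hence the chosen steps lead to cycles. A line on which all steps use g_i would
    reach a cycle whose word is made of g_i and its inverse, so a nontrivial power of g_i would fix
    a point of the line. The two values come from counting: each value at the identity is assigned
    some i for which II wins, and a map from Cantor space to the natural numbers is not injective.
    The two values write y into x(y), so the map is injective and an aperiodic y gives a line
    without such fixed points. An alternating colouring changes under every odd translation. A set
    with the Baire property is comeagre or meagre in some cylinder, and a large odd translation
    leaves room for a generic point which lies in the cylinder together with its translate; both
    then have the same colour. *)

Definition pick_in (X : Type) (x0 : X) (P : X -> Prop) : X :=
  if pselect (exists x, P x) is left h then sval (cid h) else x0.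

Lemma pick_inP (X : Type) (x0 : X) (P : X -> Prop) :
  (exists x, P x) -> P (pick_in x0 P).
Proof. by rewrite /pick_in => h; case: pselect => // h'; case: (cid h'). Qed.

Lemma take_rcons_le (X : Type) n (p : seq X) a :
  n <= size p -> take n (rcons p a) = take n p.
Proof. by move=> le; rewrite -cats1 takel_cat. Qed.

Lemma take_rcons_size (X : Type) (p : seq X) a :
  take (size p) (rcons p a) = p.
Proof. by rewrite take_rcons_le // take_size. Qed.

Lemma take_succ (X : Type) n (p : seq X) :
  n < size p -> exists a, take n.+1 p = rcons (take n p) a.
Proof. by case: p => // a p; exists (nth a (a :: p) n); exact: take_nth. Qed.

Lemma take_mkseq (X : Type) (x : nat -> X) m n :
  m <= n -> take m (mkseq x n) = mkseq x m.
Proof. by move=> le; rewrite /mkseq -map_take take_iota (minn_idPl le). Qed.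

Section Strategies.
Variable A : Type.
Implicit Types (T S Z : seq A -> Prop) (p q u : seq A) (x y : nat -> A).

(* Trees may have terminal nodes; a player who has to move at a terminal node
   loses. *)
Definition is_tree T := T [::] /\ forall p a, T (rcons p a) -> T p.

Definition branch T x := forall n, T (mkseq x n).

(* Player [false] moves at even positions, player [true] at odd ones.
   Strategies are nondeterministic and given by their set of positions; they
   are required to be strategies up to length n only, so that they can be cut
   off and transferred between trees which agree only up to some level. *)
Definition strat n (b : bool) T S :=
  [/\ S [::], forall p a, S (rcons p a) -> S p, forall p, S p -> T p,
      forall p, S p -> size p < n -> odd (size p) = b ->
        exists a, S (rcons p a)
    & forall p a, S p -> size p < n -> odd (size p) = ~~ b ->
        T (rcons p a) -> S (rcons p a)].

Lemma prefix_closed_take S p n :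
  (forall q a, S (rcons q a) -> S q) -> S p -> S (take n p).
Proof.
move=> cl; elim/last_ind: p => // p a IH Sp.
have [le|lt] := leqP n (size p); first by rewrite take_rcons_le //; apply/IH/cl/Sp.
by rewrite take_oversize // size_rcons.
Qed.

(* [her G] is the largest prefix-closed subset of [G]. *)
Definition her (G : seq A -> Prop) p := forall n, G (take n p).

Lemma her_rcons G p a : her G (rcons p a) <-> her G p /\ G (rcons p a).
Proof.
split=> [h|[h Gp] n].
  split=> [n|]; last by have := h (size p).+1; rewrite take_oversize // size_rcons.
  have [le|lt] := leqP n (size p); first by have := h n; rewrite take_rcons_le.
  by rewrite take_oversize 1?ltnW //; have := h (size p); rewrite take_rcons_size.
have [le|lt] := leqP n (size p); first by rewrite take_rcons_le.
by rewrite take_oversize // size_rcons.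
Qed.

Lemma her_nil G : her G [::] <-> G [::].
Proof. by split=> [/(_ 0)|h []]. Qed.

Lemma herE G p : her G p -> G p.
Proof. by move=> /(_ (size p)); rewrite take_size. Qed.

Lemma her_local (G G' : seq A -> Prop) n :
  (forall q, size q <= n -> G q <-> G' q) ->
  forall p, size p <= n -> her G p <-> her G' p.
Proof.
move=> GG' p sp; have sz m : size (take m p) <= n.
  by rewrite (leq_trans _ sp) // size_take_min geq_minr.
by split=> h m; [apply/GG'|apply/GG'].
Qed.

End Strategies.

(** Martin's coverings. [cov_surj], [cov_inj] and [cov_id] say that nothing changes up to length 2k,
    and [cov_local] that the transferred strategy up to length n depends only on the original one up
    to length n; both make inverse limits possible. By [cov_lift] every run by the transferred
    strategy is the projection of a run by the original one. *)
Record covering (k : nat) (A B : Type) (T : seq A -> Prop) (R : seq B -> Prop)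
    (pr : B -> A) (phi : bool -> (seq B -> Prop) -> seq A -> Prop) : Prop :=
  Covering {
  cov_tree : is_tree R;
  cov_map : forall q, R q -> T (map pr q);
  cov_surj : forall p, size p <= k.*2 -> T p -> exists2 q, R q & map pr q = p;
  cov_inj : forall q q', size q <= k.*2 -> R q -> R q' ->
    map pr q = map pr q' -> q = q';
  cov_strat : forall n b S, strat n b R S -> strat n b T (phi b S);
  cov_local : forall n b S S', (forall q, size q <= n -> S q <-> S' q) ->
    forall p, size p <= n -> phi b S p <-> phi b S' p;
  cov_id : forall n b S q, strat n b R S -> R q -> size q <= k.*2 ->
    phi b S (map pr q) <-> S q;
  cov_lift : forall b S x, (forall n, strat n b R S) -> branch (phi b S) x ->
    exists2 y, branch S y & forall n, pr (y n) = x n }.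

Lemma covering_comp k A B C (T : seq A -> Prop) (R : seq B -> Prop)
    (Q : seq C -> Prop) pr pr' phi phi' :
  covering k T R pr phi -> covering k R Q pr' phi' ->
  covering k T Q (pr \o pr') (fun b => phi b \o phi' b).
Proof.
move=> c c'; split=> /=.
- exact: cov_tree c'.
- by move=> q /(cov_map c')/(cov_map c); rewrite map_comp.
- move=> p sp Tp; have [q Rq qp] := cov_surj c sp Tp.
  have sq : size q <= k.*2 by rewrite -(size_map pr) qp.
  have [r Qr rq] := cov_surj c' sq Rq.
  by exists r => //; rewrite map_comp rq.
- move=> q q' sq Qq Qq'; rewrite !(map_comp pr pr').
  move=> /(cov_inj c) e; apply: (cov_inj c') => //; apply: e.
  + by rewrite size_map.
  + exact: (cov_map c').
  + exact: (cov_map c').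
- by move=> n b S /(cov_strat c')/(cov_strat c).
- by move=> n b S S' SS'; apply: (cov_local c); apply: (cov_local c').
- move=> n b S q sS Qq sq; rewrite map_comp.
  rewrite (cov_id c (cov_strat c' sS)) ?size_map //; last exact: cov_map c' _ Qq.
  exact: (cov_id c' sS).
- move=> b S x sS bx.
  have [y by_ yx] := cov_lift c (fun n => cov_strat c' (sS n)) bx.
  have [z bz zy] := cov_lift c' sS by_.
  by exists z => // n; rewrite zy yx.
Qed.

Definition relclosed A (T : seq A -> Prop) (W : (nat -> A) -> Prop) :=
  forall x, branch T x -> ~ W x -> exists n, forall y, branch T y ->
    mkseq y n = mkseq x n -> ~ W y.

(** That is, [W] is clopen in the space of branches of [T]. *)
Definition decides A (T : seq A -> Prop) (W : (nat -> A) -> Prop) :=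
  relclosed T W /\ relclosed T (fun x => ~ W x).

(** * The auxiliary game for a closed set *)

Section Unravel.
Variables (A : Type) (T : seq A -> Prop) (W : (nat -> A) -> Prop) (k : nat).
Hypotheses (treeT : is_tree T) (closedW : relclosed T W).
Local Notation K := k.*2.
Implicit Types (p q u : seq A) (P : seq A -> Prop) (o : option (seq A)).

(** All moves of the auxiliary game have one type. The offer P is made at level [K] and the answer o
    at level [K.+1]; every later move repeats them, and earlier slots have fixed values, so a
    position is determined by P, o and its projection. *)
Definition deco := ((seq A -> Prop) * option (seq A))%type.
Definition dec0 : deco := (fun=> False, None).
Definition dec P o n : deco :=
  if n < K then dec0 else if n == K then (P, None) else (P, o).

Fixpoint lift_from P o n p : seq (A * deco) :=
  if p is a :: p' then (a, dec P o n) :: lift_from P o n.+1 p' else [::].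
Definition lift P o p := lift_from P o 0 p.

Lemma lift_rcons P o p a :
  lift P o (rcons p a) = rcons (lift P o p) (a, dec P o (size p)).
Proof.
rewrite /lift -[size p]add0n; elim: p 0 => [|b p IH] n /=; first by rewrite addn0.
by rewrite IH addSnnS.
Qed.

Lemma map_lift P o p : map fst (lift P o p) = p.
Proof. by rewrite /lift; elim: p 0 => //= a p IH n; rewrite IH. Qed.

Lemma size_lift P o p : size (lift P o p) = size p.
Proof. by rewrite -(size_map fst) map_lift. Qed.

Lemma lift_irr P o P' o' p :
  (K < size p -> P = P') -> (K.+1 < size p -> o = o') ->
  lift P o p = lift P' o' p.
Proof.
elim/last_ind: p => // p a IH; rewrite size_rcons => hP ho.
rewrite !lift_rcons IH; [|by move=> /ltnW/hP|by move=> /ltnW/ho].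
congr rcons; congr pair; rewrite /dec.
case: ltngtP => // h; first by rewrite hP 1?ho // ltnW.
by rewrite hP // h.
Qed.

Lemma lift_inj P o P' o' p : lift P o p = lift P' o' p ->
  (K < size p -> P = P') /\ (K.+1 < size p -> o = o').
Proof.
elim/last_ind: p => // p a IH; rewrite size_rcons !lift_rcons.
move=> /rcons_inj[/IH[hP ho] ]; rewrite /dec.
case: ltngtP => h; rewrite !ltnS.
- by split=> h2; lia.
- by move=> [-> ->].
- by move=> [->]; split=> // h2; lia.
Qed.

Lemma take_lift P o n p : take n (lift P o p) = lift P o (take n p).
Proof.
have [le|lt] := leqP (size p) n; first by rewrite !take_oversize // size_lift.
elim/last_ind: p lt => // p a IH; rewrite size_rcons ltnS => le.
rewrite lift_rcons !take_rcons_le ?size_lift //.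
move: le; rewrite leq_eqVlt => /orP[/eqP ->|/IH //].
by rewrite take_size take_oversize // size_lift.
Qed.

Lemma mkseq_lift P o x n :
  mkseq (fun n => (x n, dec P o n)) n = lift P o (mkseq x n).
Proof.
elim: n => // n IH.
by rewrite !mkseqS IH lift_rcons size_mkseq.
Qed.

Definition TW p := exists2 y, branch T y /\ W y & mkseq y (size p) = p.

Definition okI P q := forall b, T (rcons q b) -> TW (rcons q b) \/ P (rcons q b).

(** [K] is even, so odd lengths are those just after a move of I. The equation between truncations
    says that p and u are comparable. *)
Definition legal P o p :=
  (K < size p -> okI P (take K.+1 p)) /\
  (K.+1 < size p -> if o is Some u
     then [/\ P u, ~ TW u, K.+1 < size u & take (size p) u = take (size u) p]
     else forall n, K.+1 < n <= size p ->
       if odd n then okI P (take n p) else TW (take n p)).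

(* At level K player I adds to his move a set P of positions at which he is
   willing to leave TW.  Player II answers either [Some u], which commits both
   players to go through the position u of P outside TW, or [None]; in the
   latter case II must stay in TW, and I must avoid the moves which allow II to
   leave TW at once at a position outside P. *)
Definition aux_tree (q : seq (A * deco)) :=
  T (map fst q) /\ exists P o, q = lift P o (map fst q) /\ legal P o (map fst q).

Lemma TW_W x : branch T x -> (forall n, exists2 m, n <= m & TW (mkseq x m)) -> W x.
Proof.
move=> Tx h; apply: contrapT => /(closedW Tx)[n hn].
have [m le [y [Ty Wy] e]] := h n; rewrite size_mkseq in e.
by apply: (hn y Ty) Wy; rewrite -(take_mkseq _ le) e take_mkseq.
Qed.

Lemma aux_liftE P o p : aux_tree (lift P o p) <-> T p /\ legal P o p.
Proof.
rewrite /aux_tree map_lift; split=> [[Tp [P' [o' [e lg]]]]|[Tp lg]].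
  have [hP ho] := lift_inj e; split=> //; case: lg => l1 l2; split=> h.
    by rewrite (hP h); exact: l1.
  rewrite (ho h) (hP (ltnW h)); exact: l2.
by split=> //; exists P, o.
Qed.

Lemma legal_rcons P o p a : legal P o (rcons p a) -> legal P o p.
Proof.
rewrite /legal size_rcons => -[l1 l2]; split=> h.
  by have := l1 (ltnW h); rewrite take_rcons_le.
have := l2 (ltnW h); case: o {l2} => [u [Pu Tu su e]|l2 n /andP[n1 n2]].
  split=> //; have := congr1 (take (size p)) e.
  rewrite -!take_min (minn_idPl (leqnSn _)) => ->.
  by rewrite minnC take_min take_rcons_size.
by have := l2 n; rewrite n1 leqW // take_rcons_le //; apply.
Qed.

Lemma aux_rcons (q : seq (A * deco)) b : aux_tree (rcons q b) ->
  exists P o p a, [/\ q = lift P o p, rcons q b = lift P o (rcons p a)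
    , T (rcons p a) & legal P o (rcons p a)].
Proof.
case; rewrite map_rcons => Tp [P [o [e lg]]]; exists P, o, (map fst q), b.1.
by split=> //; move: e; rewrite lift_rcons => /rcons_inj[<-].
Qed.

Lemma aux_is_tree : is_tree aux_tree.
Proof.
split; first by split; [case: treeT|exists (fun=> False), None; split].
move=> q b /aux_rcons[P [o [p [a [-> _ Tp lg]]]]].
by apply/aux_liftE; split; [exact: treeT.2 Tp|exact: legal_rcons lg].
Qed.

Lemma aux_step P o p b : aux_tree (rcons (lift P o p) b) ->
  exists P' o' a, [/\ rcons (lift P o p) b = lift P' o' (rcons p a),
    T (rcons p a), legal P' o' (rcons p a),
    (K < size p -> P' = P) & (K.+1 < size p -> o' = o)].
Proof.
move=> /aux_rcons[P' [o' [p' [a [e1 e2 Tp lg]]]]].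
have pp' : p' = p by rewrite -(map_lift P o p) e1 map_lift.
rewrite pp' in e1 e2 Tp lg; have [hP ho] := lift_inj e1.
by exists P', o', a; split=> // h; rewrite ?hP ?ho.
Qed.

(** A run with the answer [Some u] passes through u, which is outside [TW]; a run with the answer
    [None] has arbitrarily long initial segments in [TW], and W is closed. *)
Lemma aux_decides : decides aux_tree (fun y => W (fst \o y)).
Proof.
have key y : branch aux_tree y -> exists P o,
    (forall n, mkseq y n = lift P o (mkseq (fst \o y) n)) /\
    forall n, legal P o (mkseq (fst \o y) n).
  move=> By; have mapy n : map fst (mkseq y n) = mkseq (fst \o y) n.
    by rewrite /mkseq -map_comp.
  have [_ [P [o [e lg]]]] := By K.+2; rewrite mapy in e lg.
  have all n : mkseq y n = lift P o (mkseq (fst \o y) n).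
    have [le|lt] := leqP n K.+2.
      by rewrite -(take_mkseq _ le) e take_lift take_mkseq.
    have [_ [P' [o' [e' _]]]] := By n; rewrite mapy in e'.
    rewrite e'; apply: lift_irr; have := congr1 (take K.+2) e';
      rewrite take_lift !take_mkseq ?(ltnW lt) // e => /lift_inj;
      by rewrite size_mkseq => -[hP ho] _; rewrite ?hP ?ho // ltnW.
  exists P, o; split=> // n.
  by have := By n; rewrite all => /aux_liftE[].
have BT y : branch aux_tree y -> branch T (fst \o y).
  by move=> By n; have [] := By n; rewrite /mkseq -map_comp.
(* the answer of II at level K+1 tells whether the run is in W *)
have Wo y P o : branch aux_tree y ->
    (forall n, mkseq y n = lift P o (mkseq (fst \o y) n)) ->
    W (fst \o y) <-> o = None.
  move=> By e.
  have lg n : legal P o (mkseq (fst \o y) n).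
    by have := By n; rewrite e => /aux_liftE[].
  split=> [Wy|o0].
    case: o {e} lg => // u lg; exfalso.
    have [_] := lg (K.+2 + size u); rewrite size_mkseq => /(_ _)[]; first by lia.
    move=> Pu Tu su; rewrite take_oversize ?take_mkseq; try lia.
    by move=> ue; apply: Tu; exists (fst \o y) => //; split=> //; exact: BT.
  apply: TW_W => [|n]; first exact: BT.
  exists (K.+2 + n.*2); first lia.
  have [_] := lg (K.+2 + n.*2); rewrite size_mkseq o0 => /(_ _ (K.+2 + n.*2)).
  rewrite take_oversize ?size_mkseq // ifF; last by lia.
  by apply; lia.
have dec y z : branch aux_tree y -> branch aux_tree z ->
    mkseq z K.+2 = mkseq y K.+2 -> W (fst \o z) <-> W (fst \o y).
  move=> By Bz e; have [P [o [ey _]]] := key _ By; have [P' [o' [ez _]]] := key _ Bz.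
  rewrite (Wo _ _ _ By ey) (Wo _ _ _ Bz ez).
  have e' : mkseq (fst \o z) K.+2 = mkseq (fst \o y) K.+2.
    by have := congr1 (map fst) e; rewrite /mkseq -!map_comp.
  have := e; rewrite ey ez e' => /lift_inj[_].
  by rewrite size_mkseq => -> //.
by split=> y By nW; exists K.+2 => z Bz e; rewrite (dec y z).
Qed.


Lemma legal_some_rcons P u p a : size u <= size p -> K.+1 < size p ->
  legal P (Some u) p -> legal P (Some u) (rcons p a).
Proof.
move=> up Kp [l1 l2]; split=> _.
  by rewrite take_rcons_le; [apply: l1|]; lia.
have [Pu Tu su e] := l2 Kp; split=> //.
by rewrite take_rcons_le // -e !take_oversize ?size_rcons // leqW.
Qed.

Lemma legal_some_take P u m : K.+1 < size u -> P u -> ~ TW u ->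
  okI P (take K.+1 u) -> legal P (Some u) (take m u).
Proof.
move=> su Pu Tu ok; split; rewrite size_take_min => h.
  by rewrite take_takel //; lia.
by split=> //; rewrite -take_min minnC.
Qed.

(** After the answer [Some u] the only legal moves up to the end of u are those along u: the owner
    of Z must make them and his opponent may make them. *)
Lemma walk n b Z P u m : strat n b aux_tree Z -> T u -> K.+1 < size u ->
  size u <= n -> Z (lift P (Some u) (take K.+2 u)) -> K.+1 < m <= size u ->
  Z (lift P (Some u) (take m u)).
Proof.
move=> [_ _ ZR Zown Zopp] Tu su un Z0.
have /aux_liftE[_ [l1 l2]] := ZR _ Z0.
have sz : size (take K.+2 u) = K.+2 by rewrite size_takel.
have [Pu TWu _ _] := l2 (eq_leq (esym sz)).
have ok : okI P (take K.+1 u) by have := l1; rewrite sz take_takel //; apply.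
elim: m => // m IH /andP[m1 m2].
move: m1; rewrite ltnS leq_eqVlt => /orP[/eqP <- //|m1].
have {}IH : Z (lift P (Some u) (take m u)) by apply: IH; lia.
have [a ea] := take_succ m2; rewrite ea.
have sm : size (take m u) = m by rewrite size_takel // ltnW.
have [om|om] := eqVneq (odd m) b.
  have [||b' Zb'] := Zown _ IH; rewrite ?size_lift ?sm //; first by lia.
  have [P' [o' [a' [e _ lg hP ho]]]] := aux_step (ZR _ Zb').
  rewrite sm in hP ho; rewrite {}hP ?{}ho in e lg; [|lia|lia].
  case: lg => _; rewrite size_rcons sm => /(_ _)[]; first lia.
  move=> _ _ _; rewrite (take_oversize (n := size u)) ?size_rcons ?sm // ea.
  by move=> /rcons_inj[->]; rewrite -e.
rewrite lift_rcons; apply: Zopp => //.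
- by rewrite size_lift sm; lia.
- by rewrite size_lift sm; case: (b) (odd m) om => [] [].
rewrite -lift_rcons -ea; apply/aux_liftE; split.
  exact: prefix_closed_take treeT.2 Tu.
exact: legal_some_take.
Qed.

Lemma strat_branch n b (Z : seq (A * deco) -> Prop) y : strat n b aux_tree Z ->
  (forall m, exists2 l, m <= l & Z (mkseq y l)) -> branch Z y.
Proof.
move=> [_ cl _ _ _] h m; have [l ml Zl] := h m.
by rewrite -(take_mkseq _ ml); exact: prefix_closed_take.
Qed.

(** ** Transfer of the strategies of player I *)

Definition unexited p := forall m, K.+1 < m <= size p -> ~~ odd m -> TW (take m p).

Definition fexit u p := [/\ take (size u) p = u, K.+1 < size u, ~~ odd (size u),
  ~ TW u & unexited (take (size u).-1 u)].

Lemma unexited_rcons p a : unexited p ->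
  (K < size p -> odd (size p) -> TW (rcons p a)) -> unexited (rcons p a).
Proof.
move=> up Ta m; rewrite size_rcons => /andP[m1 m2] om.
have [le|lt] := leqP m (size p); first by rewrite take_rcons_le //; apply: up; rewrite ?m1.
have em : m = (size p).+1 by lia.
rewrite em in m1 om *.
rewrite take_oversize ?size_rcons //.
by apply: Ta; [lia|exact: negbNE].
Qed.

Lemma fexit_rcons u p a : fexit u p -> fexit u (rcons p a).
Proof.
case=> e; have le : size u <= size p by rewrite -e size_take_min geq_minr.
by split=> //; rewrite take_rcons_le.
Qed.

Lemma fexit_size u p : fexit u p -> K.+1 < size u <= size p.
Proof. by case=> e -> *; rewrite -e size_take_min geq_minr. Qed.

Lemma exited p : unexited p \/ exists u, fexit u p.
Proof.
elim/last_ind: p => [|p a [up|[u eu]]]; first by left=> m /=; lia.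
  have [c|c] := pselect (K < size p -> odd (size p) -> TW (rcons p a)).
    by left; exact: unexited_rcons.
  right; exists (rcons p a); move: c => /not_implyP[c1 /not_implyP[c2 c3]].
  by split; rewrite ?take_size ?size_rcons //= ?negbK // take_rcons_size.
by right; exists u; exact: fexit_rcons.
Qed.

Lemma fexit_unexited u p : fexit u p -> unexited p -> False.
Proof.
move=> eu; have := fexit_size eu; case: eu => e su ou Tu _ le up.
by apply: Tu; rewrite -e; exact: up.
Qed.

Lemma fexit_inj u v p : fexit u p -> fexit v p -> u = v.
Proof.
wlog le : u v / size u <= size v.
  move=> w eu ev; have [le|/ltnW le] := leqP (size u) (size v); first exact: w.
  by apply/esym; exact: w.
move=> [eu su ou Tu _] [ev _ _ _ uv].
move: le; rewrite leq_eqVlt => /orP[/eqP e|lt].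
  by rewrite -eu -ev e.
exfalso; apply: Tu; have := uv (size u).
rewrite size_takel ?leq_pred // take_takel; last by lia.
by rewrite -{2}ev take_takel ?(ltnW lt) // eu; apply=> //; lia.
Qed.

Definition PI Z p := pick_in (fun=> False) (fun P => Z (lift P None (take K.+1 p))).

(** I plays by Z as if II had answered [None]. When II first leaves [TW], at u, the condition [okI]
    puts u into the offer, and from then on I pretends that the answer was [Some u]. *)
Definition GI Z p := [/\ T p, unexited p -> Z (lift (PI Z p) None p)
  & forall u, fexit u p -> Z (lift (PI Z p) (Some u) p)].

Definition phiI Z := her (GI Z).

Lemma PI_rcons Z p a : K < size p -> PI Z (rcons p a) = PI Z p.
Proof. by move=> h; rewrite /PI take_rcons_le. Qed.

Lemma strat_phiI n Z : strat n false aux_tree Z -> strat n false T (phiI Z).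
Proof.
move=> sZ; have [Z0 Zcl ZR Zown Zopp] := sZ.
have step p a : phiI Z p -> GI Z (rcons p a) -> phiI Z (rcons p a).
  by move=> *; apply/her_rcons.
split.
- apply/her_nil; split; [exact: treeT.1|done|].
  by move=> u /fexit_size; rewrite /=; lia.
- by move=> p a /her_rcons[].
- by move=> p /herE[].
- move=> p Sp pn op; have [Tp Zp Zu] := herE Sp.
  have [up|[u eu]] := exited p; last first.
    have le := fexit_size eu.
    have [||b Zb] := Zown _ (Zu _ eu); rewrite ?size_lift //.
    have [P' [o' [a [e Ta lg hP ho]]]] := aux_step (ZR _ Zb).
    rewrite {}hP ?{}ho in e lg; [|lia|lia].
    exists a; apply: step => //; split=> // [|v].
      by move=> /(fexit_unexited (fexit_rcons a eu)).
    move=> /(fexit_inj (fexit_rcons a eu)) <-.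
    by rewrite PI_rcons -?e //; lia.
  have [||b Zb] := Zown _ (Zp up); rewrite ?size_lift //.
  have [P' [o' [a [e Ta lg hP ho]]]] := aux_step (ZR _ Zb).
  have ua : unexited (rcons p a) by apply: unexited_rcons => //; rewrite op.
  exists a; apply: step => //; split=> // [_|v ev]; last first.
    by case: (fexit_unexited ev ua).
  rewrite e in Zb; have [lt|gt|eK] := ltngtP (size p) K.
  + by rewrite (lift_irr (P' := P') (o' := o')) ?size_rcons //; lia.
  + by rewrite PI_rcons // -hP // -ho //; lia.
  + rewrite /PI take_oversize ?size_rcons ?eK //.
    apply: (@pick_inP _ _ (fun P => Z (lift P None (rcons p a)))); exists P'.
    by rewrite (lift_irr (P' := P') (o' := o')) // size_rcons; lia.
- move=> p a Sp pn op Ta; apply: step => //; have [Tp Zp Zu] := herE Sp.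
  have [up|[u eu]] := exited p; last first.
    have le := fexit_size eu.
    split=> // [|v]; first by move=> /(fexit_unexited (fexit_rcons a eu)).
    move=> /(fexit_inj (fexit_rcons a eu)) <-; rewrite PI_rcons; last by lia.
    rewrite lift_rcons; apply: Zopp; rewrite ?size_lift //; first exact: Zu.
    rewrite -lift_rcons; apply/aux_liftE; split=> //; apply: legal_some_rcons.
    - by lia.
    - by lia.
    - by have /aux_liftE[] := ZR _ (Zu _ eu).
  have {}Zp := Zp up; have /aux_liftE[_ [l1 l2]] := ZR _ Zp.
  have [lt|ge] := ltnP (size p) K.
    have ua : unexited (rcons p a) by apply: unexited_rcons => //; lia.
    split=> // [_|v ev]; last by case: (fexit_unexited ev ua).
    rewrite (lift_irr (P' := PI Z p) (o' := None)) ?size_rcons //; last by lia.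
    rewrite lift_rcons; apply: Zopp; rewrite ?size_lift // -lift_rcons.
    by apply/aux_liftE; split=> //; split; rewrite size_rcons; lia.
  have Kp : K < size p.
    by rewrite ltn_neqAle ge andbT; apply: contraTneq op => <-; rewrite odd_double.
  have ok : okI (PI Z p) p.
    move: (Kp); rewrite leq_eqVlt => /orP[/eqP e|lt].
      by have := l1 Kp; rewrite e take_size.
    by have := l2 lt (size p); rewrite lt leqnn op take_size; apply.
  have [TWa|nTWa] := pselect (TW (rcons p a)).
    have ua : unexited (rcons p a) by exact: unexited_rcons.
    split=> // [_|v ev]; last by case: (fexit_unexited ev ua).
    rewrite PI_rcons // lift_rcons; apply: Zopp; rewrite ?size_lift // -lift_rcons.
    apply/aux_liftE; split=> //; split=> _; first by rewrite take_rcons_le //; exact: l1.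
    move=> m; rewrite size_rcons => /andP[m1 m2].
    have [le|gt] := leqP m (size p).
      by rewrite take_rcons_le //; apply: l2; lia.
    have -> : m = (size p).+1 by lia.
    by rewrite /= op take_oversize ?size_rcons.
  (* II has just left [TW]. The auxiliary run is rebuilt with the answer [Some u]: it is legal at
     level [K.+1] because u is in the offer, and [walk] carries Z along u. *)
  have eu : fexit (rcons p a) (rcons p a).
    by split; rewrite ?take_size ?size_rcons //= ?op // take_rcons_size.
  split=> //; first by move=> /(fexit_unexited eu).
  move=> v /(fexit_inj eu) <- {v}; set u := rcons p a in eu *.
  have su : size u = (size p).+1 by rewrite size_rcons.
  have Pu : PI Z p u by case: (ok a Ta).
  rewrite PI_rcons // -{2}(take_size u).
  apply: (walk sZ) => //; rewrite ?su ?leqnn //; try lia.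
  have [a' ea] : exists a', take K.+2 u = rcons (take K.+1 p) a'.
    have [|a' ->] := @take_succ _ K.+1 u; first by lia.
    by exists a'; rewrite take_rcons_le.
  have sK : size (take K.+1 p) = K.+1 by rewrite size_takel.
  rewrite ea lift_rcons; apply: Zopp; rewrite ?size_lift ?sK //=.
  + rewrite (lift_irr (P' := PI Z p) (o' := None)) // ?sK ?ltnn // -take_lift.
    exact: prefix_closed_take.
  + by lia.
  + by rewrite odd_double.
  + rewrite -{2}sK -lift_rcons -ea; apply/aux_liftE; split.
      exact: prefix_closed_take treeT.2 Ta.
    apply: legal_some_take => //; first by lia.
    by rewrite take_rcons_le //; exact: l1.
Qed.

Lemma phiI_local n (Z Z' : seq (A * deco) -> Prop) :
  (forall q : seq (A * deco), size q <= n -> Z q <-> Z' q) ->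
  forall p, size p <= n -> phiI Z p <-> phiI Z' p.
Proof.
move=> ZZ'; apply: her_local => q qn.
have ePI : PI Z q = PI Z' q.
  rewrite /PI; congr pick_in; apply/funext => P; apply/propext; apply: ZZ'.
  by rewrite size_lift (leq_trans _ qn) // size_take_min geq_minr.
by rewrite /GI ePI; split=> -[Tq h1 h2]; split=> // [/h1|u /h2] /ZZ';
  rewrite size_lift; apply.
Qed.

Lemma phiI_id n Z (q : seq (A * deco)) : strat n false aux_tree Z -> aux_tree q ->
  size q <= K -> phiI Z (map fst q) <-> Z q.
Proof.
move=> [_ cl _ _ _] [Tq [P [o [eq _]]]] sq; move: eq Tq sq; set p := map fst q.
move=> -> Tp; rewrite size_lift => sp; split=> [/herE[_ h _]|Zp m].
  rewrite (lift_irr (P' := PI Z p) (o' := None)); [|by lia|by lia].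
  by apply: h => m; lia.
have sm : size (take m p) <= K by rewrite (leq_trans _ sp) // size_take_min geq_minr.
split=> [|_|u /fexit_size]; last by lia.
  exact: prefix_closed_take treeT.2 _.
rewrite (lift_irr (P' := P) (o' := o)) -?take_lift; [|by lia|by lia].
exact: prefix_closed_take.
Qed.

Lemma phiI_lift Z x : (forall n, strat n false aux_tree Z) -> branch (phiI Z) x ->
  exists2 y, branch Z y & forall n, (y n).1 = x n.
Proof.
move=> sZ Bx; set P := PI Z (mkseq x K.+1).
have eP n : K < n -> PI Z (mkseq x n) = P.
  by move=> h; rewrite /P /PI !take_mkseq.
have Bo o : (forall m, exists2 l, m <= l & Z (lift P o (mkseq x l))) ->
    exists2 y, branch Z y & forall n, (y n).1 = x n.
  move=> h; exists (fun n => (x n, dec P o n)) => //.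
  apply: (strat_branch (sZ 0)) => m; have [l ml Zl] := h m; exists l => //.
  by rewrite mkseq_lift.
have [al|/existsNP[n nn]] := pselect (forall n, unexited (mkseq x n)).
  apply: (Bo None) => m; exists (maxn m K.+1); first exact: leq_maxl.
  by rewrite -(eP (maxn m K.+1)) ?leq_maxr //; have [_ h _] := herE (Bx (maxn m K.+1)); apply: h.
have [//|[u eu]] := exited (mkseq x n).
apply: (Bo (Some u)) => m; set l := maxn m n; exists l; first exact: leq_maxl.
have le := fexit_size eu; rewrite size_mkseq in le.
have nl : n <= l by exact: leq_maxr.
rewrite -(eP l); last by lia.
have [_ _ h] := herE (Bx l); apply: h; case: eu => e su ou Tu uu; split=> //.
by rewrite -{2}e !take_mkseq //; lia.
Qed.

(** ** Transfer of the strategies of player II *)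

Definition UII (Z : seq (A * deco) -> Prop) u :=
  K.+1 < size u /\ exists P, Z (lift P (Some u) (take K.+2 u)).

Definition PU (Z : seq (A * deco) -> Prop) u :=
  pick_in (fun=> False) (fun P => Z (lift P (Some u) (take K.+2 u))).

(* If I offered the complement of UII, then the strategy Z of II could not
   challenge him. *)
Definition P0 Z u := ~ UII Z u.

Definition unswitched Z p :=
  forall m, K < m <= size p -> odd m -> okI (P0 Z) (take m p).

Definition pending Z p := [/\ K < size p, odd (size p), ~ okI (P0 Z) p
  & unswitched Z (take (size p).-1 p)].

Definition fswitch Z u p := [/\ take (size u) p = u, K.+1 < size u,
  ~~ odd (size u), ~ okI (P0 Z) (take (size u).-1 u)
  & unswitched Z (take (size u).-2 u)].

(** II plays by Z as if I had offered [P0 Z], which Z answers by [None]. If a move of I violates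
    [okI (P0 Z)], then II can leave [TW] at some u in [UII Z]; he moves there and pretends from then
    on that the offer was [PU Z u] and the answer [Some u]. Length [K.+1] is left out because [P0 Z]
    depends on Z at length [K.+2], and [cov_local] forbids looking ahead. *)
Definition GII Z p := [/\ T p,
  size p <> K.+1 -> unswitched Z p -> Z (lift (P0 Z) None p)
  & forall u, fswitch Z u p ->
      [/\ ~ TW u, UII Z u & Z (lift (PU Z u) (Some u) p)]].

Definition phiII Z := her (GII Z).

Lemma unswitched_rcons Z p a : unswitched Z p ->
  (K <= size p -> ~~ odd (size p) -> okI (P0 Z) (rcons p a)) ->
  unswitched Z (rcons p a).
Proof.
move=> up Ta m; rewrite size_rcons => /andP[m1 m2] om.
have [le|lt] := leqP m (size p).
  by rewrite take_rcons_le //; apply: up; rewrite ?m1.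
have em : m = (size p).+1 by lia.
rewrite em in m1 om *.
by rewrite take_oversize ?size_rcons //; apply: Ta.
Qed.

Lemma fswitch_rcons Z u p a : fswitch Z u p -> fswitch Z u (rcons p a).
Proof.
case=> e; have le : size u <= size p by rewrite -e size_take_min geq_minr.
by split=> //; rewrite take_rcons_le.
Qed.

Lemma fswitch_size Z u p : fswitch Z u p -> K.+1 < size u <= size p.
Proof. by case=> e -> *; rewrite -e size_take_min geq_minr. Qed.

Lemma pending_fswitch Z p a : pending Z p -> fswitch Z (rcons p a) (rcons p a).
Proof.
case=> h1 h2 h3 h4; split; rewrite ?take_size ?size_rcons //= ?negbK //.
  by rewrite take_rcons_size.
by rewrite take_rcons_le // leq_pred.
Qed.

Lemma switched Z p : [\/ unswitched Z p, pending Z p | exists u, fswitch Z u p].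
Proof.
elim/last_ind: p => [|p a [up|pp|[u eu]]].
- by apply: Or31 => m /=; lia.
- have [c|c] := pselect (K <= size p -> ~~ odd (size p) -> okI (P0 Z) (rcons p a)).
    by apply: Or31; exact: unswitched_rcons.
  apply: Or32; move: c => /not_implyP[c1 /not_implyP[c2 c3]].
  by split; rewrite ?size_rcons //= take_rcons_size.
- by apply: Or33; exists (rcons p a); exact: pending_fswitch.
- by apply: Or33; exists u; exact: fswitch_rcons.
Qed.

Lemma fswitch_witness Z u p : fswitch Z u p -> exists m,
  [/\ m.+1 = size u, K < m, odd m & ~ okI (P0 Z) (take m p)].
Proof.
case=> e su ou nu _; exists (size u).-1; split; [lia|lia|lia|].
have <- : take (size u).-1 u = take (size u).-1 p; last exact: nu.
by rewrite -{2}e take_takel // leq_pred.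
Qed.

Lemma fswitch_unswitched Z u p : fswitch Z u p -> unswitched Z p -> False.
Proof.
move=> eu up; have := fswitch_size eu; have [m [mu Km om nm]] := fswitch_witness eu.
by move=> le; apply: nm; apply: up; lia.
Qed.

Lemma fswitch_inj Z u v p : fswitch Z u p -> fswitch Z v p -> u = v.
Proof.
wlog le : u v / size u <= size v.
  move=> w eu ev; have [le|/ltnW le] := leqP (size u) (size v); first exact: w.
  by apply/esym; exact: w.
move=> eu ev; have [m [mu Km om nm]] := fswitch_witness eu.
case: ev => ev sv ov _ uv; case: eu => eu su ou _ _.
move: le; rewrite leq_eqVlt => /orP[/eqP e|lt]; first by rewrite -eu -ev e.
exfalso; apply: nm; have := uv m; rewrite size_takel; last by lia.
rewrite take_takel; last by lia.
have -> : take m v = take m p by rewrite -ev take_takel //; lia.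
by apply=> //; lia.
Qed.

Lemma UII_mainline n Z p a o : strat n true aux_tree Z -> unswitched Z p ->
  size p = K.+1 -> Z (lift (P0 Z) o (rcons p a)) -> o = None.
Proof.
case: o => // u [_ _ ZR _ _] up sp Za; exfalso.
have /aux_liftE[_ [_]] := ZR _ Za; rewrite size_rcons sp => /(_ (leqnn _))[].
move=> Pu _ su e; apply: Pu; split=> //; exists (P0 Z).
by rewrite e take_oversize // size_rcons sp.
Qed.

Lemma mainline_rcons n Z p a : strat n true aux_tree Z -> size p < n ->
  ~~ odd (size p) -> T (rcons p a) -> Z (lift (P0 Z) None p) ->
  unswitched Z (rcons p a) -> Z (lift (P0 Z) None (rcons p a)).
Proof.
move=> [_ _ ZR _ Zopp] pn op Ta Zp ua.
have /aux_liftE[_ [l1 l2]] := ZR _ Zp.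
have ok m : K < m <= (size p).+1 -> odd m -> okI (P0 Z) (take m (rcons p a)).
  by move=> h om; apply: ua => //; rewrite size_rcons.
rewrite lift_rcons; apply: Zopp; rewrite ?size_lift ?(negbTE op) // -lift_rcons.
apply/aux_liftE; split=> //; split; rewrite size_rcons => Kp.
  by apply: ok; rewrite //= ?odd_double //; lia.
move=> m /andP[m1 m2]; have [le|gt] := leqP m (size p).
  by rewrite take_rcons_le //; apply: l2; lia.
have om : odd m by lia.
by rewrite om; apply: ok => //; lia.
Qed.

Lemma strat_phiII n Z : strat n true aux_tree Z -> strat n true T (phiII Z).
Proof.
move=> sZ; have [Z0 Zcl ZR Zown Zopp] := sZ.
have step p a : phiII Z p -> GII Z (rcons p a) -> phiII Z (rcons p a).
  by move=> *; apply/her_rcons.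
split.
- apply/her_nil; split; [exact: treeT.1|done|].
  by move=> u /fswitch_size; rewrite /=; lia.
- by move=> p a /her_rcons[].
- by move=> p /herE[].
- move=> p Sp pn op; have [Tp Zp Zu] := herE Sp.
  have [up|pp|[u eu]] := switched Z p; last first.
  + have le := fswitch_size eu; have [TWu Uu Zpu] := Zu _ eu.
    have [||b Zb] := Zown _ Zpu; rewrite ?size_lift //.
    have [P' [o' [a [e Ta lg hP ho]]]] := aux_step (ZR _ Zb).
    rewrite {}hP ?{}ho in e lg; [|lia|lia].
    exists a; apply: step => //; split=> // [_|v].
      by move=> /(fswitch_unswitched (fswitch_rcons a eu)).
    by move=> /(fswitch_inj (fswitch_rcons a eu)) <-; rewrite -e.
  + have [h1 _ nok _] := pp; move: nok => /existsNP[a /not_implyP[Ta]].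
    move=> /not_orP[TWa /contrapT Ua]; set u := rcons p a.
    have eu : fswitch Z u u by exact: pending_fswitch.
    exists a; apply: step => //; split=> // [_|v].
      by move=> /(fswitch_unswitched eu).
    move=> /(fswitch_inj eu) <- {v}; split=> //.
    have su : size u = (size p).+1 by rewrite size_rcons.
    suff : Z (lift (PU Z u) (Some u) (take (size u) u)) by rewrite take_size.
    apply: (walk sZ) => //; rewrite ?su ?leqnn //; try lia.
    by apply: (@pick_inP _ _ (fun P => Z (lift P (Some u) (take K.+2 u)))); case: Ua.
  + have {}Zp : Z (lift (P0 Z) None p).
      have [eK|/Zp] := pselect (size p = K.+1); last exact.
      (* [GII] does not provide the lifted position at length [K.+1]; it is recovered from the
         preceding position by letting I offer [P0 Z]. *)
      case/lastP: p eK {Tp Zp Zu} op pn Sp up => // p a; rewrite size_rcons => -[eK] op pn.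
      move=> /her_rcons[/herE[Tp Zp _] [Ta _ _]] ua.
      apply: (mainline_rcons sZ) => //; first by lia.
      by apply: Zp => [|m]; lia.
    have [||b Zb] := Zown _ Zp; rewrite ?size_lift //.
    have [P' [o' [a [e Ta lg hP ho]]]] := aux_step (ZR _ Zb).
    have ua : unswitched Z (rcons p a) by apply: unswitched_rcons; rewrite ?op.
    exists a; apply: step => //; split=> // [_ _|v ev]; last first.
      by case: (fswitch_unswitched ev ua).
    rewrite e in Zb; have [lt|gt|eK] := ltngtP (size p) K.
    * by rewrite (lift_irr (P' := P') (o' := o')) ?size_rcons //; lia.
    * rewrite {}hP // in Zb; have [eK|nK] := eqVneq (size p) K.+1.
        by have o0 := UII_mainline sZ up eK Zb; rewrite o0 in Zb.
      by rewrite ho // in Zb; lia.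
    * by move: op; rewrite eK odd_double.
- move=> p a Sp pn /negbT op Ta; apply: step => //; have [Tp Zp Zu] := herE Sp.
  have [up|[_ op' _ _]|[u eu]] := switched Z p; last first.
  + have le := fswitch_size eu; have [TWu Uu Zpu] := Zu _ eu.
    split=> // [_|v]; first by move=> /(fswitch_unswitched (fswitch_rcons a eu)).
    move=> /(fswitch_inj (fswitch_rcons a eu)) <-; split=> //.
    rewrite lift_rcons; apply: Zopp; rewrite ?size_lift ?(negbTE op) //.
    rewrite -lift_rcons; apply/aux_liftE; split=> //; apply: legal_some_rcons.
    - by lia.
    - by lia.
    - by have /aux_liftE[] := ZR _ Zpu.
  + by rewrite op' in op.
  + split=> // [_ ua|v ev].
      apply: (mainline_rcons sZ) => //; apply: Zp => // eK.
      by rewrite eK /= odd_double in op.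
    have [m [mv Km om nm]] := fswitch_witness ev.
    have := fswitch_size ev; rewrite size_rcons => /andP[v1 v2].
    by case: nm; rewrite take_rcons_le; [apply: up|]; lia.
Qed.

Lemma phiII_local n (Z Z' : seq (A * deco) -> Prop) :
  (forall q : seq (A * deco), size q <= n -> Z q <-> Z' q) ->
  forall p, size p <= n -> phiII Z p <-> phiII Z' p.
Proof.
move=> ZZ'; apply: her_local => q qn.
have [le|gt] := leqP (size q) K.+1.
  split=> -[Tq h _]; (split=> //; last by move=> u /fswitch_size; lia) => sq _.
    rewrite (lift_irr (P' := P0 Z) (o' := None)); [|by lia|by lia].
    by apply/ZZ'; [rewrite size_lift|apply: h => // m; lia].
  rewrite (lift_irr (P' := P0 Z') (o' := None)); [|by lia|by lia].
  by apply/ZZ'; [rewrite size_lift|apply: h => // m; lia].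
have agree u P o : Z (lift P o (take K.+2 u)) = Z' (lift P o (take K.+2 u)).
  apply/propext; apply: ZZ'; rewrite size_lift (leq_trans _ qn) //.
  by rewrite (leq_trans _ gt) // size_take_min geq_minl.
have eU : UII Z = UII Z'.
  by apply/funext => u; rewrite /UII; congr (_ /\ ex _); apply/funext => P.
have ePU : PU Z = PU Z'.
  by apply/funext => u; rewrite /PU; congr pick_in; apply/funext => P.
have e0 : P0 Z = P0 Z' by rewrite /P0 eU.
rewrite /GII /fswitch /unswitched e0 eU ePU; split=> -[Tq h1 h2]; split=> //.
- by move=> h3 h4; apply/ZZ'; [rewrite size_lift|exact: h1].
- by move=> u /h2[? ? h]; split=> //; apply/ZZ'; rewrite ?size_lift.
- by move=> h3 h4; apply/ZZ'; [rewrite size_lift|exact: h1].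
- by move=> u /h2[? ? h]; split=> //; apply/ZZ'; rewrite ?size_lift.
Qed.

Lemma phiII_id n Z (q : seq (A * deco)) : strat n true aux_tree Z -> aux_tree q ->
  size q <= K -> phiII Z (map fst q) <-> Z q.
Proof.
move=> [_ cl _ _ _] [Tq [P [o [eq _]]]] sq; move: eq Tq sq; set p := map fst q.
move=> -> Tp; rewrite size_lift => sp; split=> [/herE[_ h _]|Zp m].
  rewrite (lift_irr (P' := P0 Z) (o' := None)); [|by lia|by lia].
  by apply: h => [|m]; lia.
have sm : size (take m p) <= K by rewrite (leq_trans _ sp) // size_take_min geq_minr.
split=> [|_ _|u /fswitch_size]; last by lia.
  exact: prefix_closed_take treeT.2 _.
rewrite (lift_irr (P' := P) (o' := o)) -?take_lift; [|by lia|by lia].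
exact: prefix_closed_take.
Qed.

Lemma phiII_lift Z x : (forall n, strat n true aux_tree Z) -> branch (phiII Z) x ->
  exists2 y, branch Z y & forall n, (y n).1 = x n.
Proof.
move=> sZ Bx.
have Bo P o : (forall m, exists2 l, m <= l & Z (lift P o (mkseq x l))) ->
    exists2 y, branch Z y & forall n, (y n).1 = x n.
  move=> h; exists (fun n => (x n, dec P o n)) => //.
  apply: (strat_branch (sZ 0)) => m; have [l ml Zl] := h m; exists l => //.
  by rewrite mkseq_lift.
have [al|/existsNP[n nn]] := pselect (forall n, unswitched Z (mkseq x n)).
  apply: (Bo (P0 Z) None) => m; exists (maxn m K.+2); first exact: leq_maxl.
  have [_ h _] := herE (Bx (maxn m K.+2)); apply: h => //; rewrite size_mkseq.
  by have := leq_maxr m K.+2; lia.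
have [n' [u eu]] : exists n u, fswitch Z u (mkseq x n).
  have [//|pp|[u eu]] := switched Z (mkseq x n); last by exists n, u.
  by exists n.+1, (mkseq x n.+1); rewrite mkseqS; exact: pending_fswitch.
apply: (Bo (PU Z u) (Some u)) => m; set l := maxn m n'; exists l; first exact: leq_maxl.
have le := fswitch_size eu; rewrite size_mkseq in le.
have nl : n' <= l by exact: leq_maxr.
have [_ _ /(_ u)[]//] := herE (Bx l); case: eu => e su ou Tu uu; split=> //.
by rewrite -{2}e !take_mkseq //; lia.
Qed.

Definition phi_aux (b : bool) := if b then phiII else phiI.

Lemma aux_covering : covering k T aux_tree fst phi_aux.
Proof.
split.
- exact: aux_is_tree.
- by move=> q [].
- move=> p pK Tp; exists (lift (fun=> False) None p); last exact: map_lift.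
  by apply/aux_liftE; split=> //; split; lia.
- move=> q q' sq [_ [P [o [eq _]]]] [_ [P' [o' [eq' _]]]] e.
  rewrite eq eq' e; apply: lift_irr; rewrite size_map -(size_map fst) -e size_map; lia.
- by move=> n [] S; [exact: strat_phiII|exact: strat_phiI].
- by move=> n [] S S'; [exact: phiII_local|exact: phiI_local].
- by move=> n [] S q; [exact: phiII_id|exact: phiI_id].
- by move=> [] S x; [exact: phiII_lift|exact: phiI_lift].
Qed.

Lemma closed_unravel : exists C (Q : seq C -> Prop) (pr : C -> A) phi,
  covering k T Q pr phi /\ decides Q (fun y => W (pr \o y)).
Proof.
by exists (A * deco)%type, aux_tree, fst, phi_aux; split;
  [exact: aux_covering|exact: aux_decides].
Qed.

End Unravel.

(** * Inverse limits of coverings *)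

Section Limit.
Variables (C : nat -> Type) (R : forall m, seq (C m) -> Prop).
Variables (pr : forall m, C m.+1 -> C m) (kk : nat -> nat).

Definition thread := {a : forall m, C m | forall m, pr (a m.+1) = a m}.
Definition tproj m (a : thread) : C m := sval a m.

Lemma map_tproj m (q : seq thread) : map (@pr m) (map (@tproj m.+1) q) = map (@tproj m) q.
Proof. by rewrite -map_comp; apply: eq_map => -[a ha]; rewrite /tproj /=. Qed.

Lemma tproj_inj (q q' : seq thread) :
  (forall m, map (@tproj m) q = map (@tproj m) q') -> q = q'.
Proof.
elim: q q' => [|a q IH] [|a' q'] //= h; try by have := h 0.
congr cons; last by apply: IH => m; have [] := h m.
have : sval a = sval a'.
  by apply: functional_extensionality_dep => m; have [] := h m.
by case: a a' {h} => a ha [a' ha'] /= ea; exact: eq_exist.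
Qed.

Lemma threads (L : forall m, seq (C m)) :
  (forall m, map (@pr m) (L m.+1) = L m) ->
  exists q : seq thread, forall m, map (@tproj m) q = L m.
Proof.
move=> hL; have [l el] : exists l, l = size (L 0) by exists (size (L 0)).
elim: l L hL el => [|l IH] L hL el.
  exists [::]; elim=> [|m IHm]; first by case: (L 0) el.
  by have := congr1 size (hL m); rewrite size_map -IHm; case: (L m.+1).
have hd m : {al : C m * seq (C m) | L m = al.1 :: al.2}.
  apply: cid; elim: m => [|m [[a l'] e]].
    by case: (L 0) el => // a l' _; exists (a, l').
  by have := hL m; rewrite e; case: (L m.+1) => //= b l2 _; exists (b, l2).
pose a m := (sval (hd m)).1; pose L' m := (sval (hd m)).2.
have e m : L m = a m :: L' m by rewrite /a /L'; case: (hd m).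
have ha m : pr (a m.+1) = a m by have := hL m; rewrite !e => -[].
have [|| q hq] := IH L'.
- by move=> m; have := hL m; rewrite !e => -[].
- by move: el; rewrite e => -[].
by exists (exist _ a ha :: q) => m; rewrite /= hq e.
Qed.

End Limit.

(** Downwards the position is projected; upwards it is lifted by [cov_surj], which remains possible
    at all later stages because [kk] is monotone. *)
Lemma lift_family m (C : nat -> Type) (R : forall m, seq (C m) -> Prop)
    (pr : forall m, C m.+1 -> C m) phi (kk : nat -> nat) :
  (forall m, covering (kk m) (@R m) (@R m.+1) (@pr m) (phi m)) ->
  {homo kk : i j / i <= j} ->
  forall p, R m p -> size p <= (kk m).*2 ->
  exists L : forall j, seq (C j), [/\ forall j, R j (L j),
    forall j, map (@pr j) (L j.+1) = L j & L m = p].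
Proof.
elim: m C R pr phi kk => [|m IH] C R pr phi kk cov mono p Rp sp.
  pose step j (q : seq (C j)) : seq (C j.+1) :=
    pick_in [::] (fun q' => R j.+1 q' /\ map (@pr j) q' = q).
  pose L := nat_rect (fun j => seq (C j)) p step.
  have stepP j : R j (L j) -> size (L j) <= (kk j).*2 ->
      R j.+1 (L j.+1) /\ map (@pr j) (L j.+1) = L j.
    move=> RL sL.
    apply: (@pick_inP _ [::] (fun q' => R j.+1 q' /\ map (@pr j) q' = L j)).
    by have [q Rq qe] := cov_surj (cov j) sL RL; exists q.
  have inv j : R j (L j) /\ size (L j) <= (kk j).*2.
    elim: j => // j [RL sL]; have [RL' e] := stepP _ RL sL; split=> //.
    rewrite -(size_map (@pr j)) e (leq_trans sL) // leq_double.
    exact: mono.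
  by exists L; split=> // j; have [h1 h2] := inv j; have [] := stepP j.
have [||L [RL hL eL]] := IH (C \o succn) (fun j => @R j.+1) (fun j => @pr j.+1)
    (fun j => phi j.+1) (kk \o succn) _ _ p Rp sp.
- by move=> j; exact: cov.
- by move=> i j ij; apply: mono.
exists (fun j => match j with 0 => map (@pr 0) (L 0) | j'.+1 => L j' end).
split=> // -[|j] //=; last exact: hL.
exact: cov_map (cov 0) _ (RL 0).
Qed.

Section LimitCovering.
Variables (C : nat -> Type) (R : forall m, seq (C m) -> Prop).
Variables (pr : forall m, C m.+1 -> C m) (kk : nat -> nat).
Variable (phi : forall m, bool -> (seq (C m.+1) -> Prop) -> seq (C m) -> Prop).
Hypothesis cov : forall m, covering (kk m) (@R m) (@R m.+1) (@pr m) (@phi m).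
Hypothesis kk_homo : {homo kk : i j / i <= j}.
Hypothesis kk_ge : forall m, m <= kk m.
Hypothesis tree0 : is_tree (@R 0).
Local Notation thread := (thread pr).
Local Notation proj m := (@tproj C pr m).
Implicit Types (q : seq thread) (S : seq thread -> Prop).

Definition Rlim q := forall m, @R m (map (proj m) q).

Lemma tree_all m : is_tree (@R m).
Proof. by case: m => // m; exact: cov_tree (cov m). Qed.

Lemma Rlim_tree : is_tree Rlim.
Proof.
split=> [m|q a h m]; first exact: (tree_all m).1.
by have := h m; rewrite map_rcons => /(tree_all m).2.
Qed.

Lemma Rlim_surj m p : @R m p -> size p <= (kk m).*2 ->
  exists2 q, Rlim q & map (proj m) q = p.
Proof.
move=> Rp sp; have [L [RL hL <-]] := lift_family cov kk_homo Rp sp.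
by have [q hq] := threads hL; exists q => // j; rewrite hq.
Qed.

Lemma Rlim_inj m q q' : size q <= (kk m).*2 -> Rlim q -> Rlim q' ->
  map (proj m) q = map (proj m) q' -> q = q'.
Proof.
move=> sq Rq Rq' e; apply: tproj_inj => j.
have down i : map (proj i.+1) q = map (proj i.+1) q' -> map (proj i) q = map (proj i) q'.
  by rewrite -!(map_tproj i) => ->.
have up i : map (proj (i + m)) q = map (proj (i + m)) q'.
  elim: i => // i IH; apply: (cov_inj (cov (i + m))); rewrite ?map_tproj //.
  rewrite size_map (leq_trans sq) // leq_double; apply: kk_homo.
  exact: leq_addl.
have := up j; rewrite addnC; elim: m {sq e up} => // m IH.
by rewrite addSn => /down/IH.
Qed.

Definition Eimg m S p := exists2 q, S q & map (proj m) q = p.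

(** The image of S at stage m + i, transferred down through i coverings. The image itself is known
    to be a strategy only up to the length at which stage m + i agrees with the limit. *)
Fixpoint Dimg i m b S : seq (C m) -> Prop :=
  if i is i'.+1 then phi b (@Dimg i' m.+1 b S) else @Eimg m S.

Lemma EimgE m S q : (forall q', S q' -> Rlim q') -> Rlim q ->
  size q <= (kk m).*2 -> Eimg S (map (proj m) q) <-> S q.
Proof.
move=> SR Rq sq; split=> [[q' Sq' e]|]; last by exists q.
by rewrite (Rlim_inj sq Rq (SR _ Sq') (esym e)).
Qed.

Lemma strat_le A n n' b (T S : seq A -> Prop) : n' <= n -> strat n b T S -> strat n' b T S.
Proof.
move=> le [h0 hc hs ho hp]; split=> // [p Sp sp|p a Sp sp]; [apply: ho|apply: hp] => //;
  exact: leq_trans le.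
Qed.

Lemma strat_Eimg n b m S : strat n b Rlim S -> n <= (kk m).*2 ->
  strat n b (@R m) (@Eimg m S).
Proof.
move=> [h0 hc hs ho hp] nk; split.
- by exists [::].
- move=> p a [q]; case/lastP: q => [|q c] Sq; first by case: p.
  by rewrite map_rcons => /rcons_inj[<- _]; exists q => //; exact: hc Sq.
- by move=> p [q /hs Rq <-].
- move=> p [q Sq <-]; rewrite size_map => sq oq; have [a Sa] := ho q Sq sq oq.
  by exists (proj m a), (rcons q a) => //; rewrite map_rcons.
- move=> p a [q Sq <-]; rewrite size_map => sq oq Ra.
  have [|q' Rq' eq'] := Rlim_surj Ra.
    by rewrite size_rcons size_map; exact: leq_trans nk.
  case/lastP: q' Rq' eq' => [|q' c] Rq'; first by move=> /(congr1 size); rewrite size_rcons.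
  rewrite map_rcons => /rcons_inj[e1 e2].
  have sq' : size q' <= (kk m).*2.
    by rewrite -(size_map (proj m)) e1 size_map (leq_trans (ltnW sq)).
  have e := Rlim_inj sq' (Rlim_tree.2 _ _ Rq') (hs _ Sq) e1.
  rewrite e in Rq'.
  by exists (rcons q c); [exact: hp|rewrite map_rcons e2].
Qed.

Lemma strat_Dimg n b i m S : strat n b Rlim S -> n <= (kk (m + i)).*2 ->
  strat n b (@R m) (@Dimg i m b S).
Proof.
elim: i m => [|i IH] m sS; first by rewrite addn0; exact: strat_Eimg.
by rewrite -addSnnS => h; apply: (cov_strat (cov m)); exact: IH.
Qed.

Lemma Dimg_step b i m S p : strat 0 b Rlim S -> size p <= (kk (m + i)).*2 ->
  Dimg i b S p <-> @Dimg i.+1 m b S p.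
Proof.
move=> sS; elim: i m p => [|i IH] m p; last first.
  rewrite -addSnnS => sp; apply: (cov_local (cov m) _ _ sp) => q; exact: IH.
rewrite addn0 => sp; have SR := let: And5 _ _ h _ _ := sS in h.
have sE := strat_Eimg (m := m.+1) sS (leq0n _).
suff h : @R m p -> Eimg S p <-> phi b (@Eimg m.+1 S) p.
  split=> hp; apply/h => //; first by case: hp => q /SR Rq <-.
  by have [_ _ hR _ _] := cov_strat (cov m) sE; apply: hR.
move=> Rp; have [q Rq e] := Rlim_surj Rp sp.
have sq : size q <= (kk m).*2 by rewrite -(size_map (proj m)) e.
have sq' : size q <= (kk m.+1).*2.
  by rewrite (leq_trans sq) // leq_double; exact: kk_homo.
rewrite -e EimgE // -map_tproj (cov_id (cov m) sE) ?size_map //.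
by rewrite EimgE.
Qed.

Lemma Dimg_le b i j m S p : strat 0 b Rlim S -> size p <= (kk (m + i)).*2 -> i <= j ->
  Dimg i b S p <-> @Dimg j m b S p.
Proof.
move=> sS sp /subnK <-; elim: (j - i) => // l ->; apply: Dimg_step => //.
rewrite (leq_trans sp) // leq_double; apply: kk_homo.
by rewrite leq_add2l leq_addl.
Qed.

(** By [Dimg_le] the transferred strategies stabilize at p as i grows; since [m <= kk m], the choice
    i = [size p] is late enough. *)
Definition Simg m b S p := @Dimg (size p) m b S p.

Lemma SimgE b i m S p : strat 0 b Rlim S -> size p <= (kk (m + i)).*2 ->
  Simg b S p <-> @Dimg i m b S p.
Proof.
move=> sS sp; have [le|/ltnW le] := leqP (size p) i.
  apply: Dimg_le => //; have := kk_ge (m + size p); lia.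
by rewrite /Simg -(Dimg_le sS sp le).
Qed.

Lemma strat_Simg n b m S : strat n b Rlim S -> strat n b (@R m) (@Simg m b S).
Proof.
move=> sS; have sS0 := strat_le (leq0n n) sS.
have big i l : l <= i -> l <= (kk (m + i)).*2 by have := kk_ge (m + i); lia.
have D0 i := strat_Dimg (i := i) (m := m) sS0 (leq0n _).
split.
- by rewrite /Simg; have [] := D0 0.
- move=> p a Sa; have [_ hc _ _ _] := D0 (size p).+1.
  rewrite (SimgE (i := (size p).+1)) //; last by apply: big; lia.
  apply: (hc p a); apply/(SimgE (i := (size p).+1)) => //.
  by apply: big; rewrite size_rcons.
- by move=> p Sp; have [_ _ hs _ _] := D0 (size p); exact: (hs p Sp).
- move=> p Sp sp op; have [_ _ _ ho _] := strat_Dimg (i := n) (m := m) sS (big _ _ (leqnn n)).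
  have [|a Sa] := ho p _ sp op.
    by apply/(SimgE (i := n)) => //; apply: big; lia.
  by exists a; apply/(SimgE (i := n)) => //; apply: big; rewrite size_rcons.
- move=> p a Sp sp op Ra.
  have [_ _ _ _ hp] := strat_Dimg (i := n) (m := m) sS (big _ _ (leqnn n)).
  apply/(SimgE (i := n)) => //; first by apply: big; rewrite size_rcons.
  by apply: hp => //; apply/(SimgE (i := n)) => //; apply: big; lia.
Qed.

Lemma phi_Simg b m S p : strat 0 b Rlim S ->
  phi b (@Simg m.+1 b S) p <-> @Simg m b S p.
Proof.
move=> sS; rewrite (SimgE (i := (size p).+1)) //=; last first.
  by have := kk_ge (m + (size p).+1); lia.
apply: (cov_local (cov m) (n := size p)) => // q sq; apply: SimgE => //.
by have := kk_ge (m.+1 + size p); lia.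
Qed.

Lemma Dimg_local b i m S S' n : (forall q, size q <= n -> S q <-> S' q) ->
  forall p, size p <= n -> Dimg i b S p <-> @Dimg i m b S' p.
Proof.
move=> SS'; elim: i m => [|i IH] m p sp /=; last first.
  by apply: (cov_local (cov m) _ _ sp) => q; exact: IH.
by split=> -[q Sq e]; exists q => //; apply/SS' => //; rewrite -(size_map (proj m)) e.
Qed.

Lemma limit_covering : covering (kk 0) (@R 0) Rlim (proj 0) (@Simg 0).
Proof.
split.
- exact: Rlim_tree.
- by move=> q; exact.
- by move=> p sp Rp; exact: Rlim_surj.
- by move=> q q' sq Rq Rq'; exact: Rlim_inj.
- by move=> n b S; exact: strat_Simg.
- by move=> n b S S' SS' p sp; exact: (@Dimg_local b (size p) 0 S S' n SS' p sp).
- move=> n b S q sS Rq sq; have sS0 := strat_le (leq0n n) sS.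
  rewrite (SimgE (i := 0)) ?size_map // /=; apply: EimgE => //.
  by case: sS.
move=> b S x sS Bx.
have lft m y : branch (@Simg m b S) y ->
    exists y', branch (@Simg m.+1 b S) y' /\ forall n, pr (y' n) = y n.
  move=> By; have [|y' h1 h2] := cov_lift (cov m) (b := b) (S := @Simg m.+1 b S) (x := y)
      (fun n => strat_Simg m.+1 (sS n)).
    by move=> n; apply/phi_Simg; [exact: (sS 0)|exact: By].
  by exists y'.
(* The run x is lifted through one stage after the other; at each time n the lifted moves form a
   thread. *)
pose st m := {y | branch (@Simg m b S) y}.
pose nx m (y : st m) : st m.+1 :=
  let c := cid (lft m (sval y) (svalP y)) in exist _ (sval c) (svalP c).1.
pose X := nat_rect st (exist _ x Bx) nx.
have Xpr m n : pr (sval (X m.+1) n) = sval (X m) n.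
  by rewrite /X /= /nx /=; case: cid => y [].
pose y n : thread := exist (fun a : forall m, C m => forall m, pr (a m.+1) = a m)
  (fun m => sval (X m) n) (fun m => Xpr m n).
exists y => // n.
have mapy m l : map (proj m) (mkseq y l) = mkseq (sval (X m)) l.
  by rewrite /mkseq -map_comp; apply: eq_map.
have sSn := sS 0.
have Ry l : Rlim (mkseq y l).
  move=> m; rewrite mapy; have [_ _ h _ _] := strat_Simg m sSn.
  by apply: h; exact: (svalP (X m)).
have sz : size (mkseq y n) <= (kk n).*2.
  by rewrite size_mkseq; have := kk_ge n; lia.
apply/(EimgE (m := n)) => //; first by case: sSn.
rewrite mapy; apply/(SimgE (i := 0)); rewrite ?addn0 ?size_mkseq //.
- by have := kk_ge n; lia.
- exact: (svalP (X n)).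
Qed.

End LimitCovering.

(** ** Borel sets are unravelled *)

(** The quantification over all trees R with a projection to A, and over all k, makes the notion
    stable under passing to a covering. So countably many sets can be unravelled successively, with
    longer and longer positions left unchanged. *)
Definition unravelable A (W : (nat -> A) -> Prop) :=
  forall B (R : seq B -> Prop) (pr : B -> A) k, is_tree R ->
  exists C (Q : seq C -> Prop) (pr' : C -> B) phi,
    covering k R Q pr' phi /\ decides Q (fun y => W (fun n => pr (pr' (y n)))).

Lemma decidesC A (T : seq A -> Prop) W : decides T W -> decides T (fun x => ~ W x).
Proof.
move=> [h1 h2]; split=> // x Bx /contrapT nW; have [n hn] := h1 x Bx nW.
by exists n => y By e; apply; exact: hn.
Qed.

Lemma decides_pull A B (T : seq A -> Prop) (R : seq B -> Prop) (f : B -> A) W :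
  (forall q, R q -> T (map f q)) -> decides T W -> decides R (fun y => W (f \o y)).
Proof.
move=> hf; have aux W' : relclosed T W' -> relclosed R (fun y => W' (f \o y)).
  have Bf y : branch R y -> branch T (f \o y).
    by move=> By n; have := hf _ (By n); rewrite /mkseq -map_comp.
  move=> h y By nW; have [n hn] := h _ (Bf _ By) nW; exists n => z Bz e.
  apply: hn; first exact: Bf.
  by have := congr1 (map f) e; rewrite /mkseq -!map_comp.
by move=> [h1 h2]; split; [exact: (aux W)|exact: (aux (fun x => ~ W x))].
Qed.

Lemma unravelableC A (W : (nat -> A) -> Prop) :
  unravelable W -> unravelable (fun x => ~ W x).
Proof.
move=> uW B R pr k tR; have [C [Q [pr' [phi [c d]]]]] := uW B R pr k tR.
by exists C, Q, pr', phi; split=> //; exact: decidesC d.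
Qed.

Lemma unravelable_cyl A (P : A -> Prop) n : unravelable (fun x => P (x n)).
Proof.
move=> B R pr k tR; apply: (@closed_unravel _ _ (fun y => P (pr (y n))) k tR).
move=> x Bx nP; exists n.+1 => y By e; suff -> : y n = x n by [].
by have := congr1 (fun s => nth (x n) s n) e; rewrite !nth_mkseq.
Qed.

Section Union.
Variables (A : Type) (F : nat -> (nat -> A) -> Prop).
Hypothesis uF : forall j, unravelable (F j).

Record stage := Stage {
  st_C : Type; st_R : seq st_C -> Prop; st_pr : st_C -> A;
  st_tree : is_tree st_R }.

Lemma next_stage (k j : nat) (s : stage) :
  {s' : stage & {pr : st_C s' -> st_C s & {phi |
    [/\ covering (k + j) (@st_R s) (@st_R s') pr phi,
        forall c, st_pr (pr c) = st_pr c
      & decides (@st_R s') (fun y => F j (@st_pr s' \o y))]}}}.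
Proof.
have /cid[C /cid[Q /cid[pr /cid[phi [c d]]]]] := uF j (@st_pr s) (k + j) (st_tree s).
by exists (@Stage C Q (@st_pr s \o pr) (cov_tree c)), pr, phi.
Qed.

(** The sets [F j] are made clopen one after the other, the j-th covering being faithful up to
    length 2(k + j). In the limit all of them are clopen, so the complement of the union is closed,
    and one more covering makes it clopen. *)
Lemma unravelable_bigcup : unravelable (fun x => exists j, F j x).
Proof.
move=> B R pr0 k tR.
pose stg := fix stg m := if m is m'.+1 then projT1 (next_stage k m' (stg m'))
  else @Stage B R pr0 tR.
pose C m := st_C (stg m).
pose pr m : C m.+1 -> C m := projT1 (projT2 (next_stage k m (stg m))).
pose phi m := sval (projT2 (projT2 (next_stage k m (stg m)))).
have cov m : covering (k + m) (@st_R (stg m)) (@st_R (stg m.+1)) (@pr m) (phi m).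
  by have [] := svalP (projT2 (projT2 (next_stage k m (stg m)))).
have homo : {homo addn k : i j / i <= j} by move=> i j ij; rewrite leq_add2l.
have := limit_covering cov homo (leq_addl k) tR; rewrite addn0.
pose Q := @Rlim C (fun m => @st_R (stg m)) pr; rewrite -/Q.
move: (@Simg _ _ phi 0) => phi' covl.
have prj j (a : thread pr) : pr0 (tproj 0 a) = st_pr (tproj j a).
  elim: j => // j ->; rewrite /tproj -(svalP a j) /pr.
  by have [_ -> _] := svalP (projT2 (projT2 (next_stage k j (stg j)))).
have opn : relclosed Q (fun y => ~ exists j, F j (fun n => pr0 (tproj 0 (y n)))).
  move=> y By /contrapT[j Fj].
  have [_ _ d] := svalP (projT2 (projT2 (next_stage k j (stg j)))).
  have [|_ h] := decides_pull (R := Q) (f := @tproj _ pr j.+1) _ d.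
    by move=> q; exact.
  have ej z : (fun n => pr0 (tproj 0 (z n))) =
      (@st_pr (stg j.+1) \o (@tproj _ pr j.+1 \o z)).
    by apply/funext => n /=; rewrite (prj j.+1).
  rewrite ej in Fj; have [n hn] := h y By (fun nF => nF Fj).
  exists n => z Bz e nz; apply: (hn z Bz e) => Fz; apply: nz; exists j.
  by rewrite ej.
have [C' [Q' [pr' [phi2 [cov2 d2]]]]] := closed_unravel k (cov_tree covl) opn.
exists C', Q', (@tproj _ pr 0 \o pr'), (fun b => phi' b \o phi2 b); split.
  exact: covering_comp covl cov2.
have -> : (fun y => exists j, F j (fun n => pr0 ((tproj 0 \o pr') (y n)))) =
    fun y => ~ ~ exists j, F j (fun n => pr0 ((tproj 0 \o pr') (y n))).
  by apply/funext => y; rewrite notK.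
exact: decidesC d2.
Qed.

End Union.

(** ** Determinacy *)

Section Determinacy.
Variables (A : Type) (T : seq A -> Prop).
Hypothesis treeT : is_tree T.
Implicit Types (p q : seq A) (S : seq A -> Prop) (PO W : (nat -> A) -> Prop).

Record strat_from b p S : Prop := StratFrom {
  sf_root : S p;
  sf_extends : forall q, S q -> take (size p) q = p;
  sf_tree : forall q, S q -> T q;
  sf_closed : forall q a, S (rcons q a) -> rcons q a = p \/ S q;
  sf_own : forall q, S q -> odd (size q) = b -> exists a, S (rcons q a);
  sf_opp : forall q a, S q -> odd (size q) = ~~ b -> T (rcons q a) -> S (rcons q a) }.

Definition wins_from b PO p := exists2 S, strat_from b p S &
  forall x, (forall n, size p <= n -> S (mkseq x n)) -> PO x.

Lemma wins_from_step b PO p (M : A -> Prop) : T p ->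
  (forall a, M a -> wins_from b PO (rcons p a)) ->
  (odd (size p) = b -> exists a, M a) ->
  (odd (size p) = ~~ b -> forall a, T (rcons p a) -> M a) -> wins_from b PO p.
Proof.
move=> Tp wM Mown Mopp.
have wa a : exists S, M a -> strat_from b (rcons p a) S /\
    forall x, (forall n, size p < n -> S (mkseq x n)) -> PO x.
  have [Ma|nM] := pselect (M a); last by exists (fun=> False) => /nM.
  have [S sf wS] := wM a Ma; rewrite size_rcons in wS.
  by exists S.
pose Sa a := sval (cid (wa a)).
have SaP a : M a -> strat_from b (rcons p a) (Sa a) /\
    forall x, (forall n, size p < n -> Sa a (mkseq x n)) -> PO x.
  exact: svalP (cid (wa a)).
have ext a q : M a -> Sa a q -> take (size p).+1 q = rcons p a.
  by move=> Ma Sq; have [sf _] := SaP a Ma; have := sf_extends sf Sq; rewrite size_rcons.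
exists (fun q => q = p \/ exists2 a, M a & Sa a q).
  split.
  - by left.
  - move=> q [->|[a Ma Sq]]; first by rewrite take_size.
    have := congr1 (take (size p)) (ext _ _ Ma Sq).
    by rewrite take_takel // take_rcons_size.
  - move=> q [-> //|[a Ma Sq]]; have [sf _] := SaP a Ma; exact: (sf_tree sf Sq).
  - move=> q c [->|[a Ma Sq]]; [by left|right].
    have [sf _] := SaP a Ma.
    have [/rcons_inj[-> _]|Sq'] := sf_closed sf Sq; first by left.
    by right; exists a.
  - move=> q [->|[a Ma Sq]] oq.
      have [a Ma] := Mown oq; have [sf _] := SaP a Ma.
      by exists a; right; exists a => //; exact: sf_root sf.
    have [sf _] := SaP a Ma; have [c Sc] := sf_own sf Sq oq.
    by exists c; right; exists a.
  - move=> q c [->|[a Ma Sq]] oq Tc; right.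
      have Mc := Mopp oq c Tc; exists c => //.
      by have [sf _] := SaP c Mc; exact: sf_root sf.
    by exists a => //; have [sf _] := SaP a Ma; exact: sf_opp sf _ _ Sq oq Tc.
move=> x hx.
have key n : size p < n -> exists2 a, M a & Sa a (mkseq x n).
  move=> pn; case: (hx n (ltnW pn)) => // e.
  by move: pn; rewrite -e size_mkseq ltnn.
have [a Ma Sax] := key _ (leqnn _).
have [_] := SaP a Ma; apply=> n pn.
have [c Mc Sc] := key n pn; suff <- : c = a by [].
have := ext _ _ Mc Sc; rewrite take_mkseq // => e.
have := ext _ _ Ma Sax; rewrite take_mkseq // e.
by move=> /rcons_inj[].
Qed.

Lemma wins_from_own b PO p a : odd (size p) = b -> T p ->
  wins_from b PO (rcons p a) -> wins_from b PO p.
Proof.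
move=> op Tp w; apply: (wins_from_step (M := eq a)) => //.
- by move=> _ <-.
- by exists a.
- by rewrite op; case: (b).
Qed.

Lemma wins_from_opp b PO p : odd (size p) = ~~ b -> T p ->
  (forall a, T (rcons p a) -> wins_from b PO (rcons p a)) -> wins_from b PO p.
Proof.
move=> op Tp w; apply: (wins_from_step (M := fun a => T (rcons p a))) => //.
by rewrite op; case: (b).
Qed.

(* Once the outcome of the infinite runs is decided in favour of the opponent
   of b, the latter can only win by blocking his opponent; if he is not able to
   do so, the opponent wins by avoiding the positions won by b. *)
Lemma wins_from_decided b PO PO' p : T p ->
  (forall x, branch T x -> mkseq x (size p) = p -> PO' x) ->
  wins_from b PO p \/ wins_from (~~ b) PO' p.
Proof.
move=> Tp dec; have [|nw] := pselect (wins_from b PO p); [by left|right].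
exists (fun q => [/\ take (size p) q = p, T q
    & forall m, size p <= m <= size q -> ~ wins_from b PO (take m q)]).
  have ext q a : take (size p) q = p -> T (rcons q a) ->
      (forall m, size p <= m <= size q -> ~ wins_from b PO (take m q)) ->
      ~ wins_from b PO (rcons q a) ->
      [/\ take (size p) (rcons q a) = p, T (rcons q a) & forall m,
         size p <= m <= size (rcons q a) -> ~ wins_from b PO (take m (rcons q a))].
    move=> e Ta nq na; have le : size p <= size q by rewrite -e size_take_min geq_minr.
    split=> [||m]; [by rewrite take_rcons_le|done|].
    rewrite size_rcons => /andP[m1 m2]; have [lem|gtm] := leqP m (size q).
      by rewrite take_rcons_le //; apply: nq; rewrite m1.
    by rewrite take_oversize ?size_rcons.
  split.
  - split=> // [|m /andP[m1 m2]]; first exact: take_size.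
    by rewrite take_oversize.
  - by move=> q [].
  - by move=> q [].
  - move=> q a [e Ta nq]; have [le|gt] := leqP (size p) (size q).
      right; split; [by rewrite take_rcons_le in e|exact: treeT.2 Ta|].
      move=> m /andP[m1 m2]; have := nq m; rewrite take_rcons_le //; apply.
      by rewrite m1 size_rcons leqW.
    by left; rewrite take_oversize ?size_rcons // in e.
  - move=> q [e Tq nq] oq; apply: contrapT => no.
    have le : size p <= size q by rewrite -e size_take_min geq_minr.
    have := nq (size q); rewrite take_size leqnn le => /(_ isT); apply.
    apply: wins_from_opp => // a Ta; apply: contrapT => na; apply: no.
    by exists a; exact: ext.
  - move=> q a [e Tq nq] oq Ta; apply: ext => // wa.
    have le : size p <= size q by rewrite -e size_take_min geq_minr.
    have := nq (size q); rewrite take_size leqnn le => /(_ isT); apply.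
    by apply: (wins_from_own (a := a)) => //; rewrite oq negbK.
move=> x hx; apply: dec => [n|].
  have [_ Tx _] := hx (n + size p) (leq_addl _ _).
  by rewrite -(take_mkseq x (leq_addr (size p) n)); exact: prefix_closed_take treeT.2 Tx.
by have [e _ _] := hx _ (leqnn _); rewrite -{2}e take_mkseq.
Qed.

(** If nobody wins from the root, the play can stay on positions from which nobody wins: the player
    not to move cannot win after every move, and the other one would already win if he won after
    some move. The resulting branch is decided at a finite stage, where [wins_from_decided] gives a
    winner. *)
Lemma clopen_determined W : decides T W ->
  exists b S, (forall n, strat n b T S) /\
    forall x, branch S x -> if b then ~ W x else W x.
Proof.
move=> [dW dnW]; pose PO b x := if b then ~ W x else W x.
suff [b [S sf wS]] : exists b, wins_from b (PO b) [::].
  exists b, S; split=> [n|x bx]; last by apply: wS => n _; exact: bx.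
  split.
  - exact: sf_root sf.
  - by move=> p a /(sf_closed sf)[|//]; case: p.
  - exact: sf_tree sf.
  - by move=> p Sp _; exact: sf_own sf _ Sp.
  - by move=> p a Sp _; exact: sf_opp sf _ _ Sp.
apply: contrapT => /forallNP no.
pose N p := T p /\ forall b, ~ wins_from b (PO b) p.
have next (s : {p | N p}) : {a | N (rcons (sval s) a)}.
  case: s => p [Tp nw] /=; apply: cid; apply: contrapT => nN.
  apply: (nw (~~ odd (size p))); apply: wins_from_opp => //; first by rewrite negbK.
  move=> a Ta; apply: contrapT => na; apply: nN; exists a; split=> // b.
  have [->//|ne] := eqVneq b (~~ odd (size p)).
  have -> : b = odd (size p) by case: (b) (odd _) ne => [] [].
  by move=> /(wins_from_own erefl Tp); exact: nw.
pose P := nat_rect (fun=> {p | N p}) (exist _ [::] (conj treeT.1 no))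
  (fun _ s => exist N _ (svalP (next s))).
pose x n := sval (next (P n)).
have eP n : mkseq x n = sval (P n) by elim: n => // n IH; rewrite mkseqS IH.
have NP n : N (mkseq x n) by rewrite eP; exact: svalP.
have Bx : branch T x by move=> n; have [] := NP n.
have fin b n : (forall y, branch T y -> mkseq y n = mkseq x n -> PO b y) -> False.
  move=> h; have [Tp nw] := NP n.
  have [|w|w] := @wins_from_decided (~~ b) (PO (~~ b)) (PO b) (mkseq x n) Tp.
  - by move=> y By; rewrite size_mkseq; exact: h.
  - exact: nw w.
  - by rewrite negbK in w; exact: nw w.
have [Wx|nWx] := pselect (W x).
  have [n hn] := dnW x Bx (fun nW => nW Wx).
  by apply: (fin false n) => y By e; apply: contrapT; exact: hn.
by have [n hn] := dW x Bx nWx; apply: (fin true n).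
Qed.

End Determinacy.

Theorem determinacy A (T : seq A -> Prop) (W : (nat -> A) -> Prop) :
  is_tree T -> unravelable W ->
  exists b S, (forall n, strat n b T S) /\
    forall x, branch S x -> if b then ~ W x else W x.
Proof.
move=> tT uW; have [C [Q [pr [phi [cov dec]]]]] := uW A T id 0 tT.
have [b [S [sS wS]]] := clopen_determined (cov_tree cov) dec.
exists b, (phi b S); split=> [n|x Bx]; first exact: (cov_strat cov (sS n)).
have [y By yx] := cov_lift cov sS Bx.
have <- : (fun n => pr (y n)) = x by apply/funext.
exact: wS.
Qed.

(** * The Borel structure of the shift space *)

Section GeneratedSigmaAlgebra.
Variables (X : Type) (G : (X -> Prop) -> Prop).

(** This form allows induction on the generation of a set. Through [gen_sigma_pull] it serves
    measurability, unravelability and the Baire property alike. *)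
Inductive gen_sigma : (X -> Prop) -> Prop :=
| gs_base B : G B -> gen_sigma B
| gs_compl B : gen_sigma B -> gen_sigma (fun x => ~ B x)
| gs_bigcup F : (forall n : nat, gen_sigma (F n)) ->
    gen_sigma (fun x => exists n, F n x).

Lemma gs_ext B B' : (forall x, B x <-> B' x) -> gen_sigma B -> gen_sigma B'.
Proof. by move=> e; suff -> : B = B' by []; apply/funext => x; apply/propext. Qed.

Lemma gs_or B B' : gen_sigma B -> gen_sigma B' -> gen_sigma (fun x => B x \/ B' x).
Proof.
move=> gB gB'; apply: (gs_ext (B := fun x => exists n, (if n is 0 then B else B') x)).
  move=> x; split=> [[[|n]]|[]]; [by left|by right|by exists 0|by exists 1].
by apply: gs_bigcup => -[|n].
Qed.

Lemma gs_and B B' : gen_sigma B -> gen_sigma B' -> gen_sigma (fun x => B x /\ B' x).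
Proof.
move=> gB gB'; apply: (gs_ext (B := fun x => ~ (~ B x \/ ~ B' x))).
  by move=> x; split=> [/not_orP[/contrapT h /contrapT h']|[h h'] []].
by apply/gs_compl/gs_or; exact: gs_compl.
Qed.

Lemma gs_iff B B' : gen_sigma B -> gen_sigma B' -> gen_sigma (fun x => B x <-> B' x).
Proof.
move=> gB gB'; apply: (gs_ext (B := fun x => (~ B x \/ B' x) /\ (~ B' x \/ B x))).
  move=> x; have [b|nb] := pselect (B x); have [b'|nb'] := pselect (B' x); tauto.
by apply: gs_and; apply: gs_or => //; exact: gs_compl.
Qed.

Hypothesis G0 : exists B, G B.

Lemma gs_const (P : Prop) : gen_sigma (fun=> P).
Proof.
have [B GB] := G0; have gF : gen_sigma (fun=> False).
  apply: (gs_ext (B := fun x => B x /\ ~ B x)); first by move=> x; split=> // -[].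
  by apply: gs_and; [|apply: gs_compl]; exact: gs_base.
have [p|np] := pselect P; last by apply: gs_ext gF.
by apply: gs_ext (gs_compl gF) => x; split=> // _ [].
Qed.

Lemma gs_exists (I : countType) (F : I -> X -> Prop) :
  (forall i, gen_sigma (F i)) -> gen_sigma (fun x => exists i, F i x).
Proof.
move=> gF; pose F' n x := if unpickle n is Some i then F i x else False.
apply: (gs_ext (B := fun x => exists n, F' n x)).
  move=> x; split=> [[n]|[i Fi]]; first by rewrite /F'; case: unpickle => // i; exists i.
  by exists (pickle i); rewrite /F' pickleK.
by apply: gs_bigcup => n; rewrite /F'; case: unpickle => [i|]; [exact: gF|exact: gs_const].
Qed.

Lemma gs_forall (I : countType) (F : I -> X -> Prop) :
  (forall i, gen_sigma (F i)) -> gen_sigma (fun x => forall i, F i x).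
Proof.
move=> gF; apply: (gs_ext (B := fun x => ~ exists i, ~ F i x)).
  move=> x; split=> [h i|h [i]]; last exact.
  by apply: contrapT => nF; apply: h; exists i.
by apply/gs_compl/gs_exists => i; exact: gs_compl.
Qed.

Lemma gs_imply B B' : gen_sigma B -> gen_sigma B' -> gen_sigma (fun x => B x -> B' x).
Proof.
move=> gB gB'; apply: (gs_ext (B := fun x => ~ B x \/ B' x)).
  by move=> x; rewrite implyE.
by apply: gs_or => //; exact: gs_compl.
Qed.

End GeneratedSigmaAlgebra.

Lemma gen_sigma_pull X Y (G : (X -> Prop) -> Prop) (D : (Y -> Prop) -> Prop) (g : Y -> X) :
  (forall B, G B -> D (fun y => B (g y))) ->
  (forall B, D B -> D (fun y => ~ B y)) ->
  (forall F, (forall n : nat, D (F n)) -> D (fun y => exists n, F n y)) ->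
  forall B, gen_sigma G B -> D (fun y => B (g y)).
Proof.
move=> h1 h2 h3 B; elim=> {B} [B|B _|F _ IH]; [exact: h1|exact: h2|].
exact: (h3 (fun n y => F n (g y))).
Qed.

(** The sets O as in the conclusion form a filter, which converges to x because it does so in each
    coordinate. *)
Lemma prod_nbhs_finite (I : eqType) (K : I -> topologicalType) (x : prod_topology K)
    (O : set (prod_topology K)) : nbhs x O ->
  exists (l : seq I) (U : forall i, set (K i)), (forall i, nbhs (x i) (U i)) /\
    forall y, (forall i, i \in l -> U i (y i)) -> O y.
Proof.
pose F : set_system (prod_topology K) := fun O =>
  exists (l : seq I) (U : forall i, set (K i)), (forall i, nbhs (x i) (U i)) /\
    forall y, (forall i, i \in l -> U i (y i)) -> O y.
have FF : Filter F.
  split.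
  - by exists [::], (fun=> setT); split=> // i; exact: filterT.
  - move=> P Q [l [U [hU lP]]] [l' [U' [hU' lQ]]].
    exists (l ++ l'), (fun i => U i `&` U' i); split=> [i|y hy]; first exact: filterI.
    split; [apply: lP => i il|apply: lQ => i il].
      by have [] := hy i; rewrite ?mem_cat ?il.
    by have [] := hy i; rewrite ?mem_cat ?il ?orbT.
  - by move=> P Q PQ [l [U [hU lP]]]; exists l, U; split=> // y /lP/PQ.
suff : F --> x by apply.
apply/cvg_sup => i A; rewrite nbhsE => -[B [[C oC <-] Cx] CA].
exists [:: i].
have [U hU] : exists U : forall j, set (K j),
    (forall j, nbhs (x j) (U j)) /\ U i `<=` C.
  exists (fun j => [set z | forall e : j = i, C (eq_rect j K z i e)]); split; last first.
    by move=> z h; exact: (h erefl).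
  move=> j; have [ji|ne] := pselect (j = i); last first.
    by apply: filterS filterT => z _ e.
  subst j; have := open_nbhs_nbhs (conj oC Cx); apply: filterS => z Cz e.
  by rewrite (Prop_irrelevance e erefl).
exists U; split; first exact: hU.1.
by move=> y hy; apply: CA; apply: hU.2; apply: hy; rewrite inE.
Qed.

Definition basic (l : seq (free_group * nat * bool)) (x : shift_space) : Prop :=
  all (fun c => x c.1.1 c.1.2 == c.2) l.

Lemma cantor_nbhs_finite (x : cantor_space) (O : set cantor_space) : nbhs x O ->
  exists l : seq nat, forall y, (forall k, k \in l -> y k = x k) -> O y.
Proof.
move=> /prod_nbhs_finite[l [U [hU h]]]; exists l => y yx; apply: h => i il.
by rewrite yx //; exact: nbhs_singleton.
Qed.

Lemma shift_nbhs_basic (x : shift_space) (O : set shift_space) : nbhs x O ->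
  exists2 l, basic l x & forall y, basic l y -> O y.
Proof.
move=> /prod_nbhs_finite[l [U [hU h]]].
pose L w := sval (cid (cantor_nbhs_finite (hU w))).
have LP w y : (forall k, k \in L w -> y k = x w k) -> U w y.
  exact: svalP (cid (cantor_nbhs_finite (hU w))) y.
exists [seq (w, k, x w k) | w <- l, k <- L w].
  by apply/allP => c /allpairsPdep[w [k [_ _ ->]]] /=.
move=> y /allP hy; apply: h => w wl; apply: LP => k kL; apply/eqP.
have := hy (w, k, x w k); apply; apply/allpairsPdep.
by exists w, k.
Qed.

Definition coord_base (B : shift_space -> Prop) :=
  exists w k, B = fun x => x w k = true.
Definition meas : (shift_space -> Prop) -> Prop := gen_sigma coord_base.

Lemma coord_base0 : exists B, coord_base B.
Proof. by exists (fun x => x 1%g 0 = true), 1%g, 0. Qed.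

Lemma meas_coord w k b : meas (fun x => x w k = b).
Proof.
have g : meas (fun x => x w k = true) by apply: gs_base; exists w, k.
case: b => //; apply: gs_ext (gs_compl g) => x.
by case: (x w k).
Qed.

Lemma meas_basic l : meas (basic l).
Proof.
elim: l => [|c l IH]; first by apply: gs_ext (gs_const coord_base0 True).
apply: (gs_ext (B := fun x => x c.1.1 c.1.2 = c.2 /\ basic l x)).
  move=> x; rewrite /basic /=; split=> [[-> ->]|/andP[/eqP -> ->]] //.
  by rewrite eqxx.
by apply: gs_and => //; exact: meas_coord.
Qed.

Lemma meas_open (O : set shift_space) : open O -> meas O.
Proof.
move=> oO; apply: (gs_ext (B := fun x => exists l : seq (free_group * nat * bool),
    (forall y, basic l y -> O y) /\ basic l x)).
  move=> x; split=> [[l [lO lx]]|Ox]; first exact: lO.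
  have [l lx lO] := shift_nbhs_basic (open_nbhs_nbhs (conj oO Ox)).
  by exists l.
apply: gs_exists; first exact: coord_base0.
by move=> l; apply: gs_and; [exact: gs_const coord_base0 _|exact: meas_basic].
Qed.

Lemma meas_shift g B : meas B -> meas (fun x => B (shift g x)).
Proof.
apply: gen_sigma_pull => [_ [w [k ->]]|C|F]; first exact: meas_coord.
- exact: gs_compl.
- exact: gs_bigcup.
Qed.

Lemma borel_free_part (B : set free_part) : borel_set B ->
  exists2 S, meas S & forall x : free_part, B x <-> S (val x).
Proof.
apply: (@smallest_sub _ _ _ [set B : set free_part |
    exists2 S, meas S & forall x : free_part, B x <-> S (val x)]).
  split.
  - exists (fun=> False) => //; exact: gs_const coord_base0 _.
  - move=> C [S mS CS]; exists (fun x => ~ S x); first exact: gs_compl.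
    by move=> x; rewrite setTD /= CS.
  - move=> F hF; pose S n := s2val (cid2 (hF n)).
    exists (fun x => exists n, S n x).
      by apply: gs_bigcup => n; exact: s2valP (cid2 (hF n)).
    move=> x; split=> [[n _ Fn]|[n Sn]]; exists n => //.
      by apply/(s2valP' (cid2 (hF n))).
    by apply/(s2valP' (cid2 (hF n))).
move=> O [U oU <-]; exists U; first exact: meas_open.
by move=> x.
Qed.

(** * The non-free part *)

Definition lgen (a : letter) : free_group := @FreeGroup [:: a] isT.
Definition ev (w : seq letter) : free_group := foldr (fun a g => (lgen a * g)%g) 1%g w.

Lemma lgenV a : (lgen a)^-1%g = lgen (linv a).
Proof. exact: val_inj. Qed.

Lemma ev_cat u v : ev (u ++ v) = (ev u * ev v)%g.
Proof. by elim: u => [|a u IH] /=; rewrite ?mul1g // IH mulgA. Qed.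

Lemma ev_rcons u a : ev (rcons u a) = (ev u * lgen a)%g.
Proof. by rewrite -cats1 ev_cat /= mulg1. Qed.

Lemma ev_word (g : free_group) : ev (fg_word g) = g.
Proof.
case: g => w rw; apply: val_inj => /=.
elim: w rw => //= a w IH rw; rewrite IH; last exact: (path_sorted rw).
by case: w rw {IH} => //= b w /andP[/negbTE ->].
Qed.

Lemma shiftK g x : shift g^-1%g (shift g x) = x.
Proof. by rewrite -shiftM mulVg shift1. Qed.

Lemma shiftKV g x : shift g (shift g^-1%g x) = x.
Proof. by rewrite -shiftM mulgV shift1. Qed.

Lemma min_witness (Q : nat -> Prop) : (exists n, Q n) ->
  exists2 n, Q n & forall m, m < n -> ~ Q m.
Proof.
move=> ex; have exb : exists n, `[< Q n >] by have [n Qn] := ex; exists n; apply/asboolP.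
case: (ex_minnP exb) => n /asboolP Qn mn; exists n => // m mlt Qm.
by have := mn m (introT (asboolP _) Qm); rewrite leqNgt mlt.
Qed.

Definition cyc_index := (seq letter * seq (free_group * nat * bool))%type.

(* z lies on the cycle read off from the word e.1; the last condition makes the
   cycles starting at distinct points of [cycle_start e] disjoint. *)
Definition cycle_start (e : cyc_index) (z : shift_space) : Prop :=
  [/\ ev e.1 <> 1%g, shift (ev e.1) z = z, basic e.2 z &
  forall s t, s < size e.1 -> t < size e.1 -> s <> t ->
    ~ basic e.2 (shift (ev (take t e.1)) (shift (ev (take s e.1))^-1%g z))].

Definition on_cycle_at e s x : Prop :=
  s < size e.1 /\ cycle_start e (shift (ev (take s e.1)) x).

Definition on_cycle e x : Prop := exists s, on_cycle_at e s x.

Definition hits e x : Prop := exists g, cycle_start e (shift g x).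

(** Hitting is invariant under the action, so the least index is constant on orbits and selects one
    family of cycles for each orbit; as the indices are countable, the selection is Borel. *)
Definition least_hit (e : cyc_index) x : Prop :=
  hits e x /\ forall e' : cyc_index, pickle e' < pickle e -> ~ hits e' x.

(* [leaves i x]: the chosen step from x, along the cycle through x or towards
   the closest cycle, is along the i-th generator. *)
Definition leaves (i : nat) (x : shift_space) : Prop :=
  exists e, least_hit e x /\
  ((exists s, on_cycle_at e s x /\ (nth (0, true) e.1 s).1 = i) \/
   (~ on_cycle e x /\ exists a w, [/\ a.1 = i,
      on_cycle e (shift (ev (rcons w a)) x) &
      forall w', size w' <= size w -> ~ on_cycle e (shift (ev w') x)])).

Lemma cycle_size e z : cycle_start e z -> 0 < size e.1.
Proof. by case: e => [[|a u] U] [] //=. Qed.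

Lemma cycle_on e z : cycle_start e z -> on_cycle e z.
Proof. by move=> h; exists 0; split; [exact: cycle_size h|rewrite take0 shift1]. Qed.

Lemma on_cycle_uniq e s t x : on_cycle_at e s x -> on_cycle_at e t x -> s = t.
Proof.
move=> [su [_ _ _ sep]] [tu [_ _ bt _]]; apply: contrapT => ne.
by apply: (sep s t su tu ne); rewrite shiftK.
Qed.

Lemma hits_shift e g x : hits e (shift g x) <-> hits e x.
Proof.
split=> -[h hh]; first by exists (h * g)%g; rewrite shiftM.
by exists (h * g^-1)%g; rewrite shiftM shiftK.
Qed.

Lemma least_hit_shift e g x : least_hit e x -> least_hit e (shift g x).
Proof.
by move=> [h m]; split=> [|e' /m]; [exact/hits_shift|rewrite hits_shift].
Qed.

Lemma least_hit_uniq e e' x : least_hit e x -> least_hit e' x -> e = e'.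
Proof.
move=> [h m] [h' m']; apply: (pcan_inj pickleK).
by case: (ltngtP (pickle e) (pickle e')) => // [/m'|/m].
Qed.

(** The chosen steps from a point of L stay in L and lead to a cycle. Going round the cycle also
    stays in L, so all letters of its word belong to the i-th generator, and this word fixes a point
    of L, contrary to the third hypothesis. *)
Lemma leaves_line i (L : shift_space -> Prop) :
  (forall x b, L x -> L (shift (lgen (i, b)) x)) -> (forall x, L x -> leaves i x) ->
  (forall x w, L x -> all (fun a : letter => a.1 == i) w -> ev w <> 1%g ->
     shift (ev w) x <> x) ->
  forall x, ~ L x.
Proof.
move=> Lcl Lv Lap x Lx; have [e [le _]] := Lv _ Lx.
pose L' x := L x /\ least_hit e x.
have L'cl y (a : letter) : a.1 = i -> L' y -> L' (shift (lgen a) y).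
  by case: a => j b /= -> [Ly ly]; split; [exact: Lcl|exact: least_hit_shift].
have L'v y : L' y -> (exists s, on_cycle_at e s y /\ (nth (0, true) e.1 s).1 = i) \/
    (~ on_cycle e y /\ exists a w, [/\ a.1 = i,
      on_cycle e (shift (ev (rcons w a)) y) &
      forall w', size w' <= size w -> ~ on_cycle e (shift (ev w') y)]).
  by move=> [/Lv[e' [le' h]] ly]; rewrite (least_hit_uniq ly le').
have reach n y w : L' y -> size w <= n -> on_cycle e (shift (ev w) y) ->
    exists2 z, L' z & on_cycle e z.
  elim: n y w => [|n IH] y w Ly sw wc.
    by case: w sw wc => // _; rewrite shift1; exists y.
  have [[s [sc _]]|[_ [a [v [ai vc vmin]]]]] := L'v _ Ly.
    by exists y => //; exists s.
  have vn : size v <= n.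
    by rewrite leqNgt; apply/negP => h; apply: (vmin w) => //; exact: leq_trans sw h.
  by apply: (IH _ v (L'cl _ a ai Ly) vn); rewrite -shiftM -ev_rcons.
have [[g hg] _] := le.
have [||y Ly [s [su sy]]] := reach (size (fg_word g)) x (fg_word g) _ (leqnn _).
- by [].
- by rewrite ev_word; exact: cycle_on.
have u1 := cycle_size sy; set u := e.1 in su sy u1.
set z := shift _ _ in sy; have [u_ne1 uz _ _] := sy; rewrite -/u in u_ne1 uz.
have onz t : t < size u -> on_cycle_at e t (shift (ev (take t u))^-1%g z).
  by move=> tu; split=> //; rewrite shiftKV.
have step t : t < size u -> L' (shift (ev (take t u))^-1%g z) ->
    (nth (0, true) u t).1 = i /\ L' (shift (ev (take t.+1 u))^-1%g z).
  move=> tu Lt; have ti : (nth (0, true) u t).1 = i.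
    have [[t' [tc <-]]|[nc]] := L'v _ Lt; last by case: nc; exists t; exact: onz.
    by rewrite (on_cycle_uniq tc (onz t tu)).
  split=> //; rewrite (take_nth (0, true)) // ev_rcons invgM shiftM lgenV.
  exact: L'cl.
have Ls : L' (shift (ev (take s u))^-1%g z) by rewrite /z shiftK.
have up t k : t + k <= size u -> L' (shift (ev (take t u))^-1%g z) ->
    L' (shift (ev (take (t + k) u))^-1%g z).
  elim: k => [|k IH]; first by rewrite addn0.
  rewrite addnS => tk Lt; have [] // := step (t + k).
  by apply: IH => //; exact: ltnW.
(* The cycle is entered at some place s. The rest of its word leads to z, which is also the point at
   place 0, so the whole cycle can be followed from there. *)
have Lz : L' z.
  have := up s (size u - s); rewrite subnKC ?(ltnW su) // take_size => /(_ (leqnn _) Ls).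
  by rewrite -{1}uz shiftK.
have all_i : all (fun a : letter => a.1 == i) u.
  apply/(all_nthP (0, true)) => t tu; apply/eqP.
  have [] // := step t tu; apply: (up 0 t (ltnW tu)).
  by rewrite take0 invg1 shift1.
exact: (Lap z u Lz.1 all_i u_ne1 uz).
Qed.

Lemma basic_separation n (z : shift_space) (q : nat -> nat -> shift_space) :
  exists2 U, basic U z &
    forall s t, s < n -> t < n -> q s t <> z -> ~ basic U (q s t).
Proof.
have sep (p : shift_space) : exists c : free_group * nat, p <> z -> p c.1 c.2 <> z c.1 c.2.
  have [->|ne] := pselect (p = z); first by exists (1%g, 0).
  apply: contrapT => /forallNP h; apply: ne; apply/funext => w; apply/funext => k.
  by apply: contrapT => wk; apply: (h (w, k)).
pose c s t := sval (cid (sep (q s t))).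
have cP s t : q s t <> z -> q s t (c s t).1 (c s t).2 <> z (c s t).1 (c s t).2.
  exact: svalP (cid (sep (q s t))).
exists [seq (c s t, z (c s t).1 (c s t).2) | s <- iota 0 n, t <- iota 0 n].
  by apply/allP => d /allpairsP[[s t] [_ _ ->]] /=.
move=> s t sn tn /cP ne /allP h; apply: ne; apply/eqP.
apply: (h (c s t, z (c s t).1 (c s t).2)); apply/allpairsP.
by exists (s, t); rewrite !mem_iota.
Qed.

(** Take a shortest word u of nontrivial value which fixes a point z of the orbit. If two points of
    its cycle coincided, the part of u between them would be a shorter such word or, if its value is
    trivial, could be cut out of u. So it suffices to separate z from finitely many other points. *)
Lemma nonfree_hits x g : g <> 1%g -> shift g x = x -> exists e, hits e x.
Proof.
move=> g1 gx.
pose Q n := exists u h, [/\ size u = n, ev u <> 1%g &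
  shift (ev u) (shift h x) = shift h x].
have [|n [u [h [su u1 uz]]] nmin] := @min_witness Q.
  by exists (size (fg_word g)), (fg_word g), 1%g; rewrite ev_word shift1.
set z := shift h x in uz.
have small w k : size w < n -> ev w <> 1%g -> shift (ev w) (shift k x) <> shift k x.
  by move=> wn w1 wk; apply: (nmin _ wn); exists w, k.
pose q s t := shift (ev (take t u)) (shift (ev (take s u))^-1%g z).
have qz s t : s < n -> t < n -> s <> t -> q s t <> z.
  wlog st : s t / s < t.
    move=> W sn tn ne; case: (ltngtP s t) => [lt|lt|//]; first exact: W.
    move=> e; apply: (W t s) => //; first by move=> e'; apply: ne.
    by rewrite /q -{1}e /q shiftK shiftKV.
  move=> sn tn _ e.
  pose w := drop s (take t u).
  have ut : ev (take t u) = (ev (take s u) * ev w)%g.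
    by rewrite -ev_cat /w -{1}(cat_take_drop s (take t u)) take_takel // ltnW.
  have sw : size w = t - s by rewrite size_drop size_takel // su ltnW.
  have wp : shift (ev w) (shift ((ev (take s u))^-1 * h)%g x) =
      shift ((ev (take s u))^-1 * h)%g x.
    by rewrite shiftM -/z -{2}e /q ut shiftM shiftK.
  have [w1|w1] := pselect (ev w = 1%g); last first.
    by apply: (small w _ _ w1 wp); rewrite sw; lia.
  have uu : ev u = ev (take s u ++ drop t u).
    by rewrite -{1}(cat_take_drop t u) !ev_cat ut w1 mulg1.
  apply: (small (take s u ++ drop t u) h); rewrite -?uu //.
  by rewrite size_cat size_takel ?size_drop su; lia.
have [U Uz Uq] := basic_separation n z q.
exists (u, U), h; split=> //= s t; rewrite su => sn tn st.
by apply: Uq => //; exact: qz.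
Qed.

Lemma nonfree_leaves x g : g <> 1%g -> shift g x = x -> exists i, leaves i x.
Proof.
move=> g1 gx; have [e0 he0] := nonfree_hits g1 gx.
pose Q n := exists2 e : cyc_index, pickle e = n & hits e x.
have [|n [e en he] nmin] := @min_witness Q; first by exists (pickle e0), e0.
have le : least_hit e x.
  by split=> // e' lt he'; apply: (nmin (pickle e')); [rewrite -en|exists e'].
have [[s sc]|nc] := pselect (on_cycle e x).
  by exists (nth (0, true) e.1 s).1, e; split=> //; left; exists s.
pose D n := exists2 w, size w = n & on_cycle e (shift (ev w) x).
have [|m [w wm wc] mmin] := @min_witness D.
  have [h hh] := he; exists (size (fg_word h)), (fg_word h) => //.
  by rewrite ev_word; exact: cycle_on.
case/lastP: w wm wc => [|w a] wm wc; first by rewrite shift1 in wc.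
exists a.1, e; split=> //; right; split=> //; exists a, w; split=> // w' sw wc'.
by apply: (mmin (size w')); [rewrite -wm size_rcons ltnS|exists w'].
Qed.

Definition free_shift_point (x : shift_space) : Prop :=
  forall g : free_group, g <> 1%g -> shift g x <> x.

Lemma meas_fixed g : meas (fun x => shift g x = x).
Proof.
apply: (gs_ext (B := fun x => forall d : free_group * nat,
    shift g x d.1 d.2 = true <-> x d.1 d.2 = true)).
  move=> x; split=> [h|->] //; apply/funext => w; apply/funext => k.
  by have := h (w, k) => /= e; apply/idP/idP => /e.
apply: (gs_forall coord_base0) => d; apply: gs_iff; last exact: meas_coord.
exact: (meas_shift g (meas_coord d.1 d.2 true)).
Qed.

Lemma meas_free : meas free_shift_point.
Proof.
apply: (gs_forall coord_base0) => g; apply: gs_imply.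
  exact: (gs_const coord_base0).
exact: (gs_compl (meas_fixed g)).
Qed.

Lemma meas_cycle_start e : meas (cycle_start e).
Proof.
pose S1 x := shift (ev e.1) x = x.
pose S2 x := forall st : nat * nat, [/\ st.1 < size e.1, st.2 < size e.1 & st.1 <> st.2] ->
  ~ basic e.2 (shift (ev (take st.2 e.1)) (shift (ev (take st.1 e.1))^-1%g x)).
apply: (gs_ext (B := fun x => (ev e.1 <> 1%g /\ S1 x) /\ (basic e.2 x /\ S2 x))).
  move=> x; split=> [[[h1 h2] [h3 h4]]|[h1 h2 h3 h4]].
    by split=> // s t su tu st; exact: (h4 (s, t)).
  by split=> //; split=> // -[s t] /= [su tu st]; exact: h4.
apply: gs_and; first by apply: gs_and; [exact: (gs_const coord_base0)|exact: meas_fixed].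
apply: gs_and; first exact: meas_basic.
apply: (gs_forall coord_base0) => st; apply: gs_imply; first exact: (gs_const coord_base0).
apply: gs_compl; exact: (meas_shift _ (meas_shift _ (meas_basic e.2))).
Qed.

Lemma meas_on_cycle_at e s : meas (on_cycle_at e s).
Proof.
apply: gs_and; first exact: (gs_const coord_base0).
exact: (meas_shift _ (meas_cycle_start e)).
Qed.

Lemma meas_on_cycle e : meas (on_cycle e).
Proof. by apply: (gs_exists coord_base0) => s; exact: meas_on_cycle_at. Qed.

Lemma meas_hits e : meas (hits e).
Proof.
by apply: (gs_exists coord_base0) => g; exact: (meas_shift g (meas_cycle_start e)).
Qed.

Lemma meas_leaves i : meas (leaves i).
Proof.
have cst (P : Prop) : meas (fun=> P) by exact: (gs_const coord_base0).
apply: (gs_exists coord_base0) => e; apply: gs_and.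
  apply: gs_and; first exact: meas_hits.
  apply: (gs_forall coord_base0) => e'.
  by apply: (gs_imply (cst _)); exact: (gs_compl (meas_hits e')).
apply: gs_or.
  apply: (gs_exists coord_base0) => s.
  by apply: gs_and; [exact: meas_on_cycle_at|exact: cst].
apply: gs_and; first exact: (gs_compl (meas_on_cycle _)).
apply: (gs_exists coord_base0) => a; apply: (gs_exists coord_base0) => w.
apply: (gs_ext (B := fun x => a.1 = i /\ (on_cycle e (shift (ev (rcons w a)) x) /\
    forall w', size w' <= size w -> ~ on_cycle e (shift (ev w') x)))).
  by move=> x; split=> [[h1 [h2 h3]]|[h1 h2 h3]].
apply: gs_and; first exact: cst.
apply: gs_and; first exact: (meas_shift _ (meas_on_cycle e)).
apply: (gs_forall coord_base0) => w'; apply: (gs_imply (cst _)).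
exact: (gs_compl (meas_shift _ (meas_on_cycle e))).
Qed.

(** * Category in the space of two-sided binary sequences *)

Definition cyl (s : seq bool) (y : nat -> bool) :=
  forall j, j < size s -> y j = nth false s j.

Definition extends (s t : seq bool) :=
  size s <= size t /\ forall j, j < size s -> nth false t j = nth false s j.

Lemma extends_refl s : extends s s.
Proof. by []. Qed.

Lemma extends_trans t s r : extends s t -> extends t r -> extends s r.
Proof.
move=> [h1 h2] [h3 h4]; split=> [|j js]; first exact: leq_trans h3.
by rewrite h4 ?h2 //; exact: leq_trans h1.
Qed.

Lemma cyl_extends s t y : extends s t -> cyl t y -> cyl s y.
Proof. by move=> [h1 h2] ty j js; rewrite ty ?h2 //; exact: leq_trans h1. Qed.

Lemma extends_mkseq s y n : cyl s y -> size s <= n -> extends s (mkseq y n).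
Proof.
move=> sy sn; split=> [|j js]; first by rewrite size_mkseq.
by rewrite nth_mkseq ?sy //; exact: leq_trans sn.
Qed.

Lemma cyl_nth s : cyl s (nth false s).
Proof. by []. Qed.

Definition dense_below (s : seq bool) (E : seq bool -> Prop) :=
  forall t, extends s t -> exists2 r, extends t r & E r.

Definition meets (E : seq bool -> Prop) (y : nat -> bool) := exists2 r, cyl r y & E r.

Lemma baire (I : countType) (s : seq bool) (E : I -> seq bool -> Prop) :
  (forall i, dense_below s (E i)) -> exists2 y, cyl s y & forall i, meets (E i) y.
Proof.
move=> dE; pose E' n t := if unpickle n is Some i then E i t else True.
have dE' n : dense_below s (E' n).
  by rewrite /E'; case: unpickle => [i|t]; [exact: dE|exists t].
pose st (n : nat) := {t | extends s t}.
have step n (t : st n) : {r | extends (sval t) r /\ E' n r}.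
  by apply: cid; have [r] := dE' n _ (svalP t); exists r.
pose S := nat_rect st (exist (extends s) s (extends_refl s))
  (fun n t => exist (extends s) (sval (step n t))
     (extends_trans (svalP t) (svalP (step n t)).1)).
pose a n := sval (S n).
have aS n : extends (a n) (a n.+1) by exact: (svalP (step n (S n))).1.
have aE n : E' n (a n.+1) by exact: (svalP (step n (S n))).2.
have amono n m : n <= m -> extends (a n) (a m).
  move=> /subnK <-; elim: (m - n) => // k IH; exact: extends_trans IH (aS _).
pose y j := nth false (a (pick_in 0 (fun n => j < size (a n)))) j.
have ay n : cyl (a n) y.
  move=> j jn; rewrite /y; set n' := pick_in _ _.
  have jn' : j < size (a n') by apply: (@pick_inP _ _ (fun n => j < size (a n))); exists n.
  have [le|/ltnW le] := leqP n n'; first by have [_ ->] := amono _ _ le.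
  by have [_ <-] := amono _ _ le.
exists y; first exact: (ay 0).
by move=> i; exists (a (pickle i).+1) => //; have := aE (pickle i); rewrite /E' pickleK.
Qed.

(** That is, B is comeagre in the cylinder of s. *)
Definition forces (s : seq bool) (B : (nat -> bool) -> Prop) :=
  exists2 E : nat -> seq bool -> Prop, forall n, dense_below s (E n) &
    forall y, cyl s y -> (forall n, meets (E n) y) -> B y.

Lemma forces_countable (I : countType) s (E : I -> seq bool -> Prop) B :
  (forall i, dense_below s (E i)) ->
  (forall y, cyl s y -> (forall i, meets (E i) y) -> B y) -> forces s B.
Proof.
move=> dE EB; exists (fun n t => if unpickle n is Some i then E i t else True).
  by move=> n; case: unpickle => [i|t]; [exact: dE|exists t].
by move=> y sy hy; apply: EB => // i; have := hy (pickle i); rewrite /meets pickleK.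
Qed.

Lemma forces_weaken s (B B' : (nat -> bool) -> Prop) :
  (forall y, B y -> B' y) -> forces s B -> forces s B'.
Proof. by move=> BB' [E dE EB]; exists E => // y sy /(EB y sy)/BB'. Qed.

(* The sets with the Baire property. *)
Definition decided (B : (nat -> bool) -> Prop) :=
  forall s, exists2 t, extends s t & forces t B \/ forces t (fun y => ~ B y).

Lemma decidedC B : decided B -> decided (fun y => ~ B y).
Proof.
move=> dB s; have [t st [h|h]] := dB s; exists t => //; last by left.
by right; apply: forces_weaken h => y By; apply.
Qed.

Lemma decided_finite B N :
  (forall y y', (forall j, j < N -> y j = y' j) -> B y -> B y') -> decided B.
Proof.
move=> hB s; pose y0 := nth false s; pose t := mkseq y0 (maxn N (size s)).
have tN y j : cyl t y -> j < N -> y j = y0 j.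
  move=> ty jN; have jt : j < maxn N (size s) by rewrite leq_max jN.
  by rewrite ty ?size_mkseq // nth_mkseq.
exists t; first by apply: extends_mkseq; [exact: cyl_nth|exact: leq_maxr].
have triv B' : (forall y, cyl t y -> B' y) -> forces t B'.
  move=> h; exists (fun _ _ => True) => [_ r|y ty _]; last exact: h.
  by exists r.
have [B0|nB0] := pselect (B y0); [left|right]; apply: triv => y ty.
  by apply: hB B0 => j jN; rewrite (tN y).
by move=> By; apply: nB0; apply: hB By => j; exact: tN.
Qed.

(** If no extension of s forces any [F n], then for each n densely many extensions force its
    complement; so every [F n] is meagre below s, and so is the union. *)
Lemma decided_bigcup (F : nat -> (nat -> bool) -> Prop) :
  (forall n, decided (F n)) -> decided (fun y => exists n, F n y).
Proof.
move=> dF s; have [[t [st [n tn]]]|no] :=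
    pselect (exists t, extends s t /\ exists n, forces t (F n)).
  by exists t => //; left; apply: forces_weaken tn => y; exists n.
exists s => //; right.
pose W n r := forces r (fun y => ~ F n y).
have hW n t : extends s t -> exists2 r, extends t r & W n r.
  move=> st; have [r tr [h|h]] := dF n t; exists r => //.
  by exfalso; apply: no; exists r; split; [exact: extends_trans tr|exists n].
have hE n r : exists E : nat -> seq bool -> Prop, W n r ->
    (forall j, dense_below r (E j)) /\
    forall y, cyl r y -> (forall j, meets (E j) y) -> ~ F n y.
  have [[E h1 h2]|nW] := pselect (W n r); first by exists E.
  by exists (fun _ _ => True) => /nW.
pose E n r := sval (cid (hE n r)).
have EP n r (w : W n r) := svalP (cid (hE n r)) w.
pose I := (nat + nat * seq bool * nat)%type.
(* The dense sets witnessing [W n r] are dense only below r; accepting also every t incompatible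
   with r makes them dense below s. *)
pose H (i : I) (t : seq bool) : Prop := match i with
  | inl n => W n t
  | inr (n, r, j) => W n r -> (forall y, cyl t y -> ~ cyl r y) \/ E n r j t
  end.
apply: (@forces_countable I s H) => [[n|[[n r] j]] t st|y sy hy [n Fn]].
- exact: hW.
- have [w|nw] := pselect (W n r); last by exists t.
  have [[y [ty ry]]|nc] := pselect (exists y, cyl t y /\ cyl r y); last first.
    by exists t => // _; left=> y ty ry; apply: nc; exists y.
  have [dE _] := EP n r w.
  have [|u ur Eu] := dE j (mkseq y (maxn (size t) (size r))).
    by apply: extends_mkseq => //; exact: leq_maxr.
  exists u; last by right.
  by apply: extends_trans ur; apply: extends_mkseq => //; exact: leq_maxl.
have [r ry w] := hy (inl n); have [_ h] := EP n r w.
apply: (h y ry) Fn => j; have [t ty ht] := hy (inr (n, r, j)).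
by exists t => //; case: (ht w) => // /(_ y ty).
Qed.

Definition enc (m : int) : nat :=
  match m with Posz n => n.*2 | Negz n => n.*2.+1 end.
Definition dec_int (n : nat) : int := if odd n then Negz n./2 else Posz n./2.

Lemma encK : cancel enc dec_int.
Proof. by move=> [n|n]; rewrite /dec_int /= odd_double ?uphalf_double ?doubleK. Qed.

Lemma dec_intK : cancel dec_int enc.
Proof. by move=> n; rewrite /dec_int; case: ifP => o /=; lia. Qed.

Lemma bounded_below (f : nat -> nat) n : exists L, forall j, j < n -> f j < L.
Proof.
elim: n => [|n [L hL]]; first by exists 0.
exists (maxn L (f n).+1) => j; rewrite ltnS leq_eqVlt leq_max => /orP[/eqP ->|/hL ->//].
by rewrite ltnSn orbT.
Qed.

Lemma enc_ge n m : (Posz n <= m)%R -> n.*2 <= enc m.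
Proof. by case: m => m /=; lia. Qed.

Definition translate (k : int) (y : int -> bool) : int -> bool := fun m => y (m + k)%R.

Definition aperiodic (y : int -> bool) := forall k : int, k <> 0%R -> translate k y <> y.

(** C or its complement is comeagre in the cylinder of t0, which fixes only integers of absolute
    value at most k. Translation by 2k + 1 moves these off themselves, so some smaller cylinder s0
    is mapped into that of t0 by the translation. A point of s0 which is generic together with its
    translate lies in C exactly if the translate does. *)
Lemma no_alternation (C : (int -> bool) -> Prop) :
  decided (fun h => C (h \o enc)) ->
  exists y k, aperiodic y /\ (C y <-> C (translate (Posz k.*2.+1) y)).
Proof.
move=> dC; have [t0 _ ft] := dC [::].
pose B (h : nat -> bool) := C (h \o enc).
have [B' [fB' B'C]] : exists B' : (nat -> bool) -> Prop, forces t0 B' /\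
    forall h h', B' h -> B' h' -> C (h \o enc) <-> C (h' \o enc).
  by case: ft => f; [exists B|exists (fun h => ~ B h)]; split.
case: fB' => E dE EB'.
pose k := (size t0); pose K : int := Posz k.*2.+1.
pose p n := enc (dec_int n + K)%R; pose r n := enc (dec_int n - K)%R.
have pK n : r (p n) = n by rewrite /r /p encK GRing.addrK dec_intK.
have rK n : p (r n) = n by rewrite /r /p encK GRing.subrK dec_intK.
have pbig j : j < k -> k <= p j.
  move=> jk; have : (Posz k <= dec_int j + K)%R by rewrite /dec_int /K; case: ifP => _; lia.
  by rewrite /p => /enc_ge; lia.
have [L0 hL0] := bounded_below p k.
pose h0 n := if n < k then nth false t0 n else nth false t0 (r n).
pose s0 := mkseq h0 (maxn k L0).
have s0_0 : extends t0 s0.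
  apply: extends_mkseq; last exact: leq_maxl.
  by move=> j jk; rewrite /h0 jk.
have s0_p y : cyl s0 y -> cyl t0 (y \o p).
  move=> sy j jk /=; have jL : p j < maxn k L0 by rewrite leq_max hL0 ?orbT.
  by rewrite sy ?size_mkseq // nth_mkseq // /h0 ltnNge pbig //= pK.
pose I := (nat + nat + nat)%type.
pose H (i : I) (t : seq bool) : Prop := match i with
  | inl (inl n) => E n t
  | inl (inr n) => exists2 u, E n u & forall y, cyl t y -> cyl u (y \o p)
  | inr m => exists j : int, [/\ enc j < size t, enc (j + Posz m.+1)%R < size t &
      nth false t (enc j) <> nth false t (enc (j + Posz m.+1)%R)]
  end.
have [y sy hy] : exists2 y, cyl s0 y & forall i, meets (H i) y.
  apply: baire => -[[n|n]|m] t st.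
  - by apply: dE; exact: extends_trans st.
  - pose h1 := nth false t; have [L1 hL1] := bounded_below r (size t).
    have [|u hu Eu] := dE n (mkseq (h1 \o p) (maxn k L1)).
      apply: extends_mkseq; last exact: leq_maxl.
      by apply: s0_p; apply: cyl_extends st _.
    pose h2 n := nth false u (r n); have [L2 hL2] := bounded_below p (size u).
    exists (mkseq h2 (maxn (size t) L2)).
      apply: extends_mkseq; last exact: leq_maxl.
      move=> j jt; have jL : r j < maxn k L1 by rewrite leq_max hL1 ?orbT.
      by rewrite /h2 hu.2 ?size_mkseq // nth_mkseq //= rK.
    exists u => // y hy j ju /=; have jL : p j < maxn (size t) L2.
      by rewrite leq_max hL2 ?orbT.
    by rewrite hy ?size_mkseq // nth_mkseq // /h2 pK.
  (* To exclude the period m + 1, the values at the integers a and a + m + 1 are made different;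
     their codes lie beyond t. *)
  - pose a := size t; pose h1 n := if n < a then nth false t n else n == a.*2.
    exists (mkseq h1 (a + m.+1).*2.+1).
      by apply: extends_mkseq => [j jt|]; [rewrite /h1 jt|lia].
    exists (Posz a); rewrite size_mkseq /=.
    have e1 : (a.*2 < a) = false by lia.
    have e2 : ((a + m.+1).*2 < a) = false by lia.
    have e3 : ((a + m.+1).*2 == a.*2) = false by lia.
    split; [lia|lia|].
    by rewrite !nth_mkseq /h1 ?e1 ?e2 ?e3 ?eqxx //; lia.
exists (y \o enc), k; split.
  have ap m : exists j : int, y (enc j) <> y (enc (j + Posz m.+1)%R).
    have [t ty [j [j1 j2 ne]]] := hy (inr m); exists j; rewrite !ty //.
  move=> [[|m]|m] // _ e; have [j] := ap m; apply.
    by have := congr1 (fun g => g j) e.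
  have := congr1 (fun g => g (j + Posz m.+1)%R) e; rewrite /translate /= => <-.
  by congr (y (enc _)); lia.
have -> : translate (Posz k.*2.+1) (y \o enc) = (y \o p) \o enc.
  by apply/funext => m; rewrite /translate /= /p encK.
apply: B'C; apply: EB'.
- exact: cyl_extends sy.
- by move=> n; exact: (hy (inl (inl n))).
- exact: s0_p.
- by move=> n; have [t ty [u Eu tu]] := hy (inl (inr n)); exists u => //; exact: tu.
Qed.

(** * The games *)

(** A move is defined at all words, but [outcome] reads the n-th move of a player only at words of
    length n + 1; so no move has to be forbidden and the tree is full. *)
Definition move := seq letter -> cantor_space.
Definition move0 : move := fun _ _ => false.
Definition full_tree (p : seq move) := True.

Lemma full_is_tree : is_tree full_tree.
Proof. by []. Qed.

(* In the i-th game, player I chooses x at the words of length n.+1 which start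
   with the i-th generator or its inverse by his n-th move, and player II does
   so at the other nonempty words; a is the value of x at the identity. *)
Definition outcome (i : nat) (a : cantor_space) (r : nat -> move) : shift_space :=
  fun w => if fg_word w is c :: w' then
      (if c.1 == i then r (size w').*2 (fg_word w) else r (size w').*2.+1 (fg_word w))
    else a.

Lemma outcome_unravelable i a B : meas B -> unravelable (fun r => B (outcome i a r)).
Proof.
apply: gen_sigma_pull => [_ [w [k ->]]|C|F].
- rewrite /outcome; case: (fg_word w) => [|c w'].
    exact: (@unravelable_cyl _ (fun=> a k = true) 0).
  by case: (c.1 == i); exact: (@unravelable_cyl _ (fun m : move => m (c :: w') k = true) _).
- exact: unravelableC.
- exact: unravelable_bigcup.
Qed.

Definition II_wins (D : shift_space -> Prop) i a :=
  exists2 S, forall n, strat n true full_tree S &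
    forall r, branch S r -> D (outcome i a r).

Definition I_wins (D : shift_space -> Prop) i a :=
  exists2 S, forall n, strat n false full_tree S &
    forall r, branch S r -> ~ D (outcome i a r).

Lemma I_or_II_wins (D : shift_space -> Prop) i a : meas D -> I_wins D i a \/ II_wins D i a.
Proof.
move=> mD; have [[] [S [sS wS]]] :=
  determinacy full_is_tree (unravelableC (outcome_unravelable i a mD)).
- by right; exists S => // r Br; apply: contrapT; exact: wS.
- by left; exists S.
Qed.

Definition best_move (S : seq move -> Prop) p := pick_in move0 (fun m => S (rcons p m)).

Lemma best_moveP b S p : (forall n, strat n b full_tree S) -> S p ->
  odd (size p) = b -> S (rcons p (best_move S p)).
Proof.
move=> sS Sp op; have [_ _ _ ho _] := sS (size p).+1.
by apply: (@pick_inP _ _ (fun m => S (rcons p m))); exact: ho.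
Qed.

Lemma any_moveP b S p m : (forall n, strat n b full_tree S) -> S p ->
  odd (size p) = ~~ b -> S (rcons p m).
Proof.
by move=> sS Sp op; have [_ _ _ _ hp] := sS (size p).+1; apply: hp.
Qed.

Lemma branch_even S b r : (forall n, strat n b full_tree S) ->
  (forall n, S (mkseq r n.*2)) -> branch S r.
Proof.
move=> sS h n; have [_ cl _ _ _] := sS 0.
by rewrite -(take_mkseq r (_ : n <= n.*2)); [exact: prefix_closed_take|lia].
Qed.

(* Winning strategies of I in all the games can be played against each other,
   the moves of I in one game being part of the moves of II in the others. *)
Lemma I_cannot_win_all (D : nat -> shift_space -> Prop) a :
  (forall x, exists i, D i x) -> ~ forall i, I_wins (D i) i a.
Proof.
move=> cov win; pose S i := s2val (cid2 (win i)).
have sS i : forall n, strat n false full_tree (S i) := s2valP (cid2 (win i)).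
have wS i : forall r, branch (S i) r -> ~ D i (outcome i a r) := s2valP' (cid2 (win i)).
(* At a word starting with the j-th generator or its inverse, x follows the strategy for the j-th
   game. The joint move is given to II in every game, where it is read only at words starting with
   other generators. *)
pose join (P : nat -> seq move) : move := fun w =>
  if w is c :: _ then best_move (S c.1) (P c.1) w else a.
pose P n : nat -> seq move := iter n
  (fun P i => rcons (rcons (P i) (best_move (S i) (P i))) (join P)) (fun=> [::]).
have PS n i : P n.+1 i = rcons (rcons (P n i) (best_move (S i) (P n i))) (join (P n)).
  by [].
have szP n i : size (P n i) = n.*2.
  by elim: n => // n IH; rewrite PS !size_rcons IH doubleS.
have SP n i : S i (P n i).
  elim: n => [|n IH]; first by have [] := sS i 0.
  rewrite PS; apply: any_moveP; rewrite ?size_rcons ?szP /= ?odd_double //.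
  by apply: best_moveP; rewrite ?szP ?odd_double.
pose r i t := if odd t then join (P t./2) else best_move (S i) (P t./2 i).
have rP i n : mkseq (r i) n.*2 = P n i.
  elim: n => // n IH; rewrite doubleS !mkseqS IH PS /r /= odd_double /= uphalf_double.
  by rewrite doubleK.
pose x : shift_space := fun w =>
  if fg_word w is c :: w' then join (P (size w')) (fg_word w) else a.
have xE i : x = outcome i a (r i).
  apply/funext => w; rewrite /x /outcome; case: (fg_word w) => // c w'.
  rewrite /r /= odd_double /= uphalf_double doubleK.
  by case: eqP => // <-.
have [i Dx] := cov x; apply: (wS i (r i)); last by rewrite -xE.
by apply: branch_even => [|n]; [exact: sS|rewrite rP].
Qed.

(* [unwind i w] is (l, u) when w = g_i^l u and u does not start with a power of
   the generator g_i. *)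
Definition sgn (b : bool) : int := if b then 1%R else (-1)%R.

Fixpoint unwind (i : nat) (w : seq letter) : int * seq letter :=
  if w is c :: w' then
    if c.1 == i then ((unwind i w').1 + sgn c.2, (unwind i w').2)%R else (0%R, w)
  else (0%R, [::]).

Lemma unwind_lcons i b w : reduced w ->
  unwind i (lcons (i, b) w) = ((unwind i w).1 + sgn b, (unwind i w).2)%R.
Proof.
case: w => [|c w] rw /=; first by rewrite eqxx.
case: eqP => [->|ne] /=; last by rewrite eqxx.
rewrite eqxx /=; case: (unwind i w) => l u /=; congr pair.
by case: b => /=; rewrite ?GRing.subrK ?GRing.addrK.
Qed.

Lemma size_unwind i w :
  `|(unwind i w).1|%N + size (unwind i w).2 <= size w.
Proof.
elim: w => //= c w IH; case: ifP => _ //=.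
by move: IH; case: (unwind i w) => l u /=; case: c.2 => /=; lia.
Qed.

(** * Playing along the line of one generator *)

Section LinePlay.
Variables (D : shift_space -> Prop) (i : nat) (a : bool -> cantor_space).
Variable (S : bool -> seq move -> Prop).
Hypothesis sS : forall b n, strat n true full_tree (S b).
Hypothesis wS : forall b r, branch (S b) r -> D (outcome i (a b) r).
Hypothesis a_inj : injective a.
Implicit Types (y : int -> bool) (m l : int) (w u : seq letter).

(* II follows his winning strategies in the games played at all the points
   g_i^m x; the moves of I at the point g_i^m x in the direction of g_i are part
   of the moves of II at the other points of the line. *)
Definition imove y n (Q : int -> seq move) m : move := fun w =>
  if size w == n.+1 then
    let l := (unwind i w).1 in let u := (unwind i w).2 in
    if u is _ :: _ then nth move0 (Q (m - l)%R) (size u).*2.-1 u else a (y (m - l)%R)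
  else fun=> false.

Fixpoint play y n m : seq move :=
  if n is n'.+1 then
    let p := rcons (play y n' m) (imove y n' (play y n') m) in
    rcons p (best_move (S (y m)) p)
  else [::].

Lemma size_play y n m : size (play y n m) = n.*2.
Proof. by elim: n => //= n IH; rewrite !size_rcons IH doubleS. Qed.

Lemma S_play y n m : S (y m) (play y n m).
Proof.
elim: n => [|n IH] /=; first by have [] := sS (y m) 0.
apply: (best_moveP (sS (y m))); rewrite ?size_rcons ?size_play /= ?odd_double //.
by apply: (any_moveP _ (sS (y m))); rewrite ?size_play ?odd_double.
Qed.

Definition line_run y m t : move := nth move0 (play y t.+1 m) t.

Lemma nth_play y n m t : t < n.*2 -> nth move0 (play y n m) t = line_run y m t.
Proof.
have mono n' k : t < n'.*2 ->
    nth move0 (play y (k + n') m) t = nth move0 (play y n' m) t.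
  move=> tn; elim: k => // k <-; rewrite addSn /=.
  by rewrite !nth_rcons !size_rcons size_play !ifT //; lia.
move=> tn; rewrite /line_run; have [le|/ltnW le] := leqP n t.+1.
  by rewrite -(subnK le) mono.
by rewrite -(subnK le) mono //; lia.
Qed.

Lemma mkseq_line_run y m n : mkseq (line_run y m) n.*2 = play y n m.
Proof.
apply: (@eq_from_nth _ move0); rewrite size_mkseq ?size_play // => t tn.
by rewrite nth_mkseq // nth_play.
Qed.

(** For w = g_i^l u, the value of x at w is that of g_i^(-l) x at u. The moves of II have odd
    indices; the one that fixes words of length [size u] has index [(size u).*2.-1]. *)
Definition line_point y : shift_space := fun w : free_group =>
  let l := (unwind i (fg_word w)).1 in let u := (unwind i (fg_word w)).2 in
  if u is _ :: _ then line_run y (- l)%R (size u).*2.-1 u else a (y (- l)%R).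

(** For a word starting with g_i or its inverse, the remainder u is shorter than the word, so the
    move of I reads only moves of II that have already been made. *)
Lemma line_pointE y : line_point y = outcome i (a (y 0%R)) (line_run y 0%R).
Proof.
apply/funext => w; rewrite /line_point /outcome; case: (fg_word w) => [|c v] /=.
  by rewrite GRing.oppr0.
case: eqP => ci /=; last by rewrite GRing.oppr0.
rewrite -(@nth_play y (size v).+1 0%R (size v).*2) /=; last by lia.
rewrite nth_rcons size_rcons size_play ltnSn nth_rcons size_play ltnn eqxx.
rewrite /imove /= eqxx ci eqxx /= GRing.sub0r.
have := size_unwind i v; case: (unwind i v) => l [|d u] //= h.
by rewrite nth_play //; lia.
Qed.

Lemma D_line_point y : D (line_point y).
Proof.
rewrite line_pointE; apply: wS; apply: (branch_even (b := true)) => [|n].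
  exact: sS.
by rewrite mkseq_line_run; exact: S_play.
Qed.

Lemma play_translate k y n m : play (translate k y) n m = play y n (m + k)%R.
Proof.
elim: n m => //= n IH m; rewrite IH.
have -> : imove (translate k y) n (play (translate k y) n) m =
    imove y n (play y n) (m + k)%R.
  apply/funext => w; rewrite /imove; case: ifP => // _.
  case: (unwind i w) => l [|d u] /=; rewrite ?IH /translate; first by rewrite GRing.addrAC.
  by rewrite GRing.addrAC.
by [].
Qed.

Lemma line_run_translate k y m t : line_run (translate k y) m t = line_run y (m + k)%R t.
Proof. by rewrite /line_run play_translate. Qed.

Lemma shift_line_point b y :
  shift (lgen (i, b)) (line_point y) = line_point (translate (sgn b) y).
Proof.
apply/funext => w; rewrite /shift lgenV.
have e : fg_word (lgen (linv (i, b)) * w)%g = lcons (i, ~~ b) (fg_word w) by [].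
rewrite /line_point e unwind_lcons; last by case: w {e}.
case: (unwind i (fg_word w)) => l [|d u] /=; rewrite ?line_run_translate /translate;
  have -> : (- (l + sgn (~~ b)) = - l + sgn b)%R by case: (b); rewrite /sgn /=; lia.
  by [].
by [].
Qed.

Definition total (w : seq letter) : int := foldr (fun c s => s + sgn c.2)%R 0%R w.

Lemma shift_ev_line_point w y : all (fun c : letter => c.1 == i) w ->
  shift (ev w) (line_point y) = line_point (translate (total w) y).
Proof.
elim: w => [|[j b] w IH] /=.
  by move=> _; rewrite shift1; congr line_point; apply/funext => m;
    rewrite /translate GRing.addr0.
move=> /andP[/eqP -> /IH e]; rewrite shiftM e shift_line_point; congr line_point.
by apply/funext => m; rewrite /translate -GRing.addrA [in RHS]GRing.addrC -GRing.addrA;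
  congr (y _); lia.
Qed.

Lemma total_nseq n b : total (nseq n (i, b)) = (sgn b * Posz n)%R.
Proof. by elim: n => [|n /= ->]; case: b => /=; lia. Qed.

(** The value of g_i^m x(y) at the identity is [a (y m)], and [a] is injective. *)
Lemma line_point_inj : injective line_point.
Proof.
move=> y y' e; apply/funext => m.
have [n [b em]] : exists n b, m = (sgn b * Posz n)%R.
  by case: m => n; [exists n, true|exists n.+1, false]; rewrite /sgn; lia.
have tr z : line_point (translate m z) = shift (ev (nseq n (i, b))) (line_point z).
  by rewrite shift_ev_line_point ?total_nseq ?em // all_nseq /= eqxx orbT.
have := congr1 (fun z : shift_space => z 1%g) (tr y); rewrite e -tr.
by rewrite /line_point /= GRing.oppr0 /translate GRing.add0r => /a_inj.
Qed.

Lemma ev_total w : all (fun c : letter => c.1 == i) w -> total w = 0%R -> ev w = 1%g.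
Proof.
pose gp (m : int) := match m with
  | Posz n => ev (nseq n (i, true)) | Negz n => ev (nseq n.+1 (i, false)) end.
have lgK b (g : free_group) : (lgen (i, b) * (lgen (i, ~~ b) * g) = g)%g.
  by rewrite -[lgen (i, ~~ b)]/(lgen (linv (i, b))) -lgenV mulgA mulgV mul1g.
have gpS b m : (lgen (i, b) * gp m = gp (m + sgn b)%R)%g.
  have gpE m' : (m + sgn b = m')%R -> (lgen (i, b) * gp m = gp m')%g ->
    (lgen (i, b) * gp m = gp (m + sgn b)%R)%g by move=> ->.
  case: b m gpE => -[[|n]|[|n]] gpE.
  - by apply: (gpE (Posz 1)).
  - by apply: (gpE (Posz n.+2)); [rewrite /sgn; lia|].
  - by apply: (gpE (Posz 0)) => //; exact: (lgK true).
  - by apply: (gpE (Negz n)); [rewrite /sgn; lia|exact: (lgK true)].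
  - by apply: (gpE (Negz 0)).
  - by apply: (gpE (Posz n)); [rewrite /sgn; lia|exact: (lgK false)].
  - by apply: (gpE (Negz 1)).
  - by apply: (gpE (Negz n.+2)); [rewrite /sgn; lia|].
suff h : forall w, all (fun c : letter => c.1 == i) w -> ev w = gp (total w).
  by move=> /h -> ->.
elim=> // -[j b] v IH /= /andP[/eqP -> /IH ->].
exact: gpS.
Qed.

Lemma line_point_aperiodic y w : aperiodic y -> all (fun c : letter => c.1 == i) w ->
  ev w <> 1%g -> shift (ev w) (line_point y) <> line_point y.
Proof.
move=> ay wi w1; rewrite shift_ev_line_point // => /line_point_inj e.
have [t0|tn] := pselect (total w = 0%R); first by apply: w1; exact: ev_total.
exact: ay tn e.
Qed.

Lemma aperiodic_translate k y : aperiodic y -> aperiodic (translate k y).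
Proof.
move=> ay m m0 e; apply: (ay m m0); apply/funext => j.
have := congr1 (fun z => z (j - k)%R) e; rewrite /translate GRing.subrK.
by rewrite GRing.addrAC GRing.subrK.
Qed.

(** Round n reads the play at points of the line at distance at most n + 1, so the window grows by
    this amount. This yields the continuity of [line_point]. *)
Lemma play_local n : exists R : nat, forall y y' m,
  (forall j : int, (m - Posz R <= j)%R -> (j <= m + Posz R)%R -> y j = y' j) ->
  play y n m = play y' n m.
Proof.
elim: n => [|n [R hR]]; first by exists 0.
exists (R + n.+1) => y y' m yy' /=.
have pe k : (`|k| <= n.+1)%N -> play y n (m - k)%R = play y' n (m - k)%R.
  by move=> hk; apply: hR => j h1 h2; apply: yy'; lia.
have -> : imove y n (play y n) m = imove y' n (play y' n) m.
  apply/funext => w; rewrite /imove; case: ifP => // /eqP sw.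
  have := size_unwind i w; rewrite sw; case: (unwind i w) => l [|d u] /= h.
    by rewrite yy' //; lia.
  by rewrite pe //; lia.
have := pe 0%R (leq0n _); rewrite GRing.subr0 => ->.
by have -> : y m = y' m by apply: yy'; lia.
Qed.

Lemma line_point_local (w : free_group) : exists R : nat, forall y y',
  (forall j : int, (- Posz R <= j)%R -> (j <= Posz R)%R -> y j = y' j) ->
  line_point y w = line_point y' w.
Proof.
have [R hR] := play_local (size (fg_word w)).*2.+1.
exists (R + size (fg_word w)) => y y' yy'; rewrite /line_point.
have := size_unwind i (fg_word w); case: (unwind i (fg_word w)) => l [|d u] /= h.
  by rewrite yy' //; lia.
have su : (size u).*2.+1 < (size (fg_word w)).*2.+1.*2 by lia.
rewrite -!(nth_play _ _ su) (hR y y') // => j h1 h2.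
by apply: yy'; lia.
Qed.

Lemma decided_line_point B : meas B -> decided (fun h => B (line_point (h \o enc))).
Proof.
apply: gen_sigma_pull => [_ [w [k ->]]|C|F]; first last.
- exact: decided_bigcup.
- exact: decidedC.
have [R hR] := line_point_local w.
apply: (@decided_finite _ R.*2.+2) => h h' hh'.
rewrite (hR (h \o enc) (h' \o enc)) // => j h1 h2; apply: hh'.
by case: j h1 h2 => j /=; lia.
Qed.

End LinePlay.

(** * The contradiction and the one-one reduction *)

Lemma nat_index_not_injective (f : cantor_space -> nat) :
  exists x y, x <> y /\ f x = f y.
Proof.
apply: contrapT => no.
have inj x y : f x = f y -> x = y.
  by move=> e; apply: contrapT => ne; apply: no; exists x, y.
pose code n := pick_in (fun=> false) (fun x : cantor_space => f x = n).
pose d : cantor_space := fun n => ~~ code n n.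
have e : code (f d) = d.
  apply: inj; apply: (@pick_inP _ _ (fun x : cantor_space => f x = f d)).
  by exists d.
have : code (f d) (f d) = ~~ code (f d) (f d) by rewrite {1}e.
by case: (code _ _).
Qed.

Lemma free_shift_pointP x : free_shift_point x <-> x \in free_part.
Proof. by rewrite inE. Qed.

Lemma fixed_coordinate (f : free_part -> cantor_space) : borel_fun f ->
  exists x : free_part, forall i : nat, f x i = f (free_shift (gen i) x) i.
Proof.
move=> hf; apply: contrapT => no.
have bit i : exists2 B, meas B & forall x : free_part, f x i = true <-> B (val x).
  apply: borel_free_part; apply: (hf [set y : cantor_space | y i = true]).
  apply: sub_sigma_algebra.
  apply: (@open_comp cantor_space bool (fun y => y i) [set true]).
    by move=> y _; exact: (@proj_continuous nat (fun=> bool) i y).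
  exact: discrete_open.
pose B i := s2val (cid2 (bit i)).
have mB i : meas (B i) := s2valP (cid2 (bit i)).
have BE i : forall x : free_part, f x i = true <-> B i (val x) :=
  s2valP' (cid2 (bit i)).
pose D i x := (free_shift_point x /\ ~ (B i x <-> B i (shift (gen i) x))) \/
  (~ free_shift_point x /\ leaves i x).
have mD i : meas (D i).
  apply: gs_or; apply: gs_and.
  - exact: meas_free.
  - by apply/gs_compl/gs_iff; [exact: mB|exact: (meas_shift _ (mB i))].
  - exact: (gs_compl meas_free).
  - exact: meas_leaves.
have cover x : exists i, D i x.
  have [fx|nfx] := pselect (free_shift_point x); last first.
    have /existsNP[g /not_implyP[g1 /contrapT gx]] := nfx.
    by have [i li] := nonfree_leaves g1 gx; exists i; right.
  apply: contrapT => /forallNP nD; apply: no.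
  exists (SigSub ((free_shift_pointP x).1 fx)) => i.
  have := nD i => /not_orP[/not_andP[//|/contrapT e] _].
  by apply/idP/idP => /(BE i _)/e h; apply/(BE i _).
have win a : exists i, II_wins (D i) i a.
  apply: contrapT => /forallNP nw; apply: (I_cannot_win_all (a := a) cover) => i.
  by have [//|/nw] := I_or_II_wins i a (mD i).
pose ix a := sval (cid (win a)).
have ixP a : II_wins (D (ix a)) (ix a) a := svalP (cid (win a)).
have [a0 [a1 [ne e]]] := nat_index_not_injective ix.
set i := ix a0 in e.
pose a b := if b then a1 else a0.
have a_inj : injective a by move=> [] [] //= h; case: ne.
have winb b : II_wins (D i) i (a b).
  by case: b; [rewrite e; exact: ixP|exact: ixP].
pose S b := s2val (cid2 (winb b)).
have sS b : forall n, strat n true full_tree (S b) := s2valP (cid2 (winb b)).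
have wS b : forall r, branch (S b) r -> D i (outcome i (a b) r) :=
  s2valP' (cid2 (winb b)).
pose X := line_point i a S.
have DX y : D i (X y) by exact: D_line_point.
have XT b y : shift (lgen (i, b)) (X y) = X (translate (sgn b) y).
  exact: shift_line_point.
have freeX y : aperiodic y -> free_shift_point (X y).
  move=> ay; apply: contrapT => nf.
  (* These points are closed under g_i and its inverse and lie in [D i] without being free, so they
     all leave along g_i, which [leaves_line] excludes. *)
  pose L x := exists y, [/\ aperiodic y, ~ free_shift_point (X y) & x = X y].
  apply: (@leaves_line i L _ _ _ (X y)); last by exists y.
  - move=> _ b [z [az nfz ->]]; exists (translate (sgn b) z); split=> //.
      exact: aperiodic_translate.
    rewrite -XT => /free_shift_pointP /(shift_free_part (lgen (i, b))^-1%g).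
    by rewrite shiftK => /free_shift_pointP.
  - by move=> _ [z [az nfz ->]]; case: (DX z) => [[/nfz]|[]].
  - by move=> _ w [z [az _ ->]]; exact: line_point_aperiodic.
have flip y : aperiodic y -> ~ (B i (X y) <-> B i (X (translate 1%R y))).
  move=> ay; rewrite -(XT true).
  by case: (DX y) => [[]|[/(_ (freeX y ay))]].
have [y [k [ay]]] := @no_alternation (fun y => B i (X y))
  (@decided_line_point i a S _ (mB i)).
have tr1 n z : translate (Posz n.+1) z = translate 1%R (translate (Posz n) z).
  by apply/funext => m; rewrite /translate; congr (z _); lia.
(* Two consecutive changes of colour cancel, so the colour is the same after an even translation;
   one more step contradicts the odd translation given by [no_alternation]. *)
have even_k : B i (X y) <-> B i (X (translate (Posz k.*2) y)).
  elim: k => [|k IH].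
    by have -> : translate (Posz 0) y = y by
      apply/funext => m; rewrite /translate GRing.addr0.
  have not_iff (P Q R : Prop) : ~ (P <-> Q) -> ~ (Q <-> R) -> P <-> R.
    by have [p|p] := pselect P; have [q|q] := pselect Q; have [r|r] := pselect R; tauto.
  have f1 := flip _ (@aperiodic_translate (Posz k.*2) _ ay).
  have f2 := flip _ (@aperiodic_translate (Posz k.*2.+1) _ ay).
  rewrite -(tr1 k.*2) in f1; rewrite -(tr1 k.*2.+1) in f2.
  by rewrite doubleS; apply: iff_trans IH (not_iff _ _ _ f1 f2).
move=> h; apply: (flip _ (@aperiodic_translate (Posz k.*2) _ ay)).
by rewrite -(tr1 k.*2); apply: iff_trans (iff_sym even_k) h.
Qed.

Lemma diagonal_computable (p : pairing) : computable1 (fun n => p (n, n)).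
Proof.
have [c hc] := pair_code_computable p.
exists (RComp c (fun=> RProj (@ord0 0))) => v.
exists [tuple tnth v ord0; tnth v ord0].
  by move=> j /=; rewrite (tnth_nth 0) /=; case: j => -[|[|]].
have := hc [tuple tnth v ord0; tnth v ord0].
by rewrite !(tnth_nth 0).
Qed.

Theorem theorem3p9 (f : free_part -> cantor_space) (hf : borel_fun f) :
  (forall p : pairing, exists x : free_part,
     one_one_reducible (f x)
       (countable_join p (fun i : nat => f (free_shift (gen i) x)))) /\
  (exists x : free_part, forall i : nat, f x i = f (free_shift (gen i) x) i).
Proof.
have [x hx] := fixed_coordinate hf.
split; last by exists x.
(* The n-th bit is found in the n-th member of the join, so the reduction is the diagonal of the
   pairing. *)
move=> p; exists x, (fun n => p (n, n)); split.
- exact: diagonal_computable.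
- by move=> m n /(congr1 (unpair p)); rewrite !pair_codeK => -[].
- by move=> n; rewrite countable_joinE.
Qed.
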